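(* Let $(G,\lambda)$ be a hypergraph matching problem with incidence matrix $A\in\mathbb{N}^{n\times m}$ (columns $A_1,\dots,A_m$, all nonzero) and arrival-rate vector $\lambda\in\mathbb{R}_{>0}^n$. The following are equivalent: (i) $(G,\lambda)$ is stabilizable; (ii) for every $y\in\mathbb{R}^n\setminus\{0\}$ such that $\langle y,A_k\rangle\ge 0$ for all $k\in\{1,\dots,m\}$, we have $\langle y,\lambda\rangle>0$; (iii) $A$ is surjective and there exists $\mu\in\mathbb{R}^m$ with $\mu_k>0$ for all $k$ and $A\mu=\lambda$; equivalently, $\lambda\in\operatorname{int}\operatorname{cone}(A)$; (iv) there exists $\mu\in\mathbb{R}_{\ge0}^m$ with $A\mu=\lambda$ such that the submatrix of $A$ formed by the columns $A_k$ with $k\in\operatorname{supp}(\mu)$ is surjective.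
   Context: $\mathbb{N}$ contains $0$. A hypergraph $G=(V,E)$ has classes $V=\{1,\dots,n\}$ and hyperedges $E=\{1,\dots,m\}$, described by an incidence matrix $A\in\mathbb{N}^{n\times m}$ with nonzero columns $A_k$: activating hyperedge $k$ removes $A_{i,k}$ items of class $i$ for each $i$ (entries $\ge 2$ and columns $A_k=e_i$ are allowed). $\operatorname{cone}(A)=A\,\mathbb{R}_{\ge0}^m$. A matrix with $n$ rows is surjective if its column span is $\mathbb{R}^n$. Items of class $i$ arrive one at a time according to independent Poisson processes with rates $\lambda_i>0$. Write $\Lambda=\sum_i\lambda_i$, $\bar\lambda=\lambda/\Lambda$; the arrival classes at successive arrival epochs $t=0,1,2,\dots$ are i.i.d. with law $\bar\lambda$. Unmatched items wait in queues $X(t)\in\mathbb{N}^n$. A matching policy consists of a countable set $I$ of internal states with a distinguished initial value, and a (possibly randomized, using fresh independent randomness) time-homogeneous rule which, at each arrival epoch $t$, as a function of the current state $S(t)=(X(t),\text{internal state})$ and the arriving class $a(t)\in\{e_1,\dots,e_n\}$ alone, chooses the numbers of activations $s(t)\in\mathbb{N}^m$ and the next internal state. Activations are allowed only if the queues (including the arriving item) suffice, i.e. $A s(t)\le X(t)+a(t)$, and then $X(t+1)=X(t)+a(t)-As(t)\ge 0$. The number of activations per epoch $\|s(t)\|_1$ is uniformly bounded. The policy may idle ($s(t)=0$). The system starts empty: $X(0)=0$, internal state at its initial value. Thus $(S(t))_{t\in\mathbb{N}}$ (the embedded chain) is a time-homogeneous Markov chain on a countable state space, and the continuous-time process is its uniformization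 at constant rate $\Lambda$. The model (problem plus policy) is stable if the embedded chain is positive recurrent on the communicating class of the initial (empty) state (equivalently, the continuous-time chain is). The problem $(G,\lambda)$ is stabilizable if some matching policy makes it stable. *)

(* Defs.v *)
From HB Require Import structures.
From mathcomp Require Import all_boot all_order all_algebra.
From mathcomp Require Import all_classical all_reals all_analysis.

Set Implicit Arguments.
Unset Strict Implicit.
Unset Printing Implicit Defensive.

Import Order.TTheory GRing.Theory Num.Theory.
Import numFieldNormedType.Exports.

Local Open Scope classical_set_scope.
Local Open Scope ring_scope.

Section MarkovChain.
Variables (R : realType) (S : choiceType) (P : S -> S -> \bar R).
Local Open Scope ereal_scope.

Fixpoint nstep (t : nat) (x y : S) : \bar R :=
  if t is t'.+1 then \esum_(z in setT) (P x z * nstep t' z y)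
  else if x == y then 1 else 0.

Definition accessible (x y : S) : Prop := exists t, 0 < nstep t x y.

Definition communicates (x y : S) : Prop := accessible x y /\ accessible y x.

(** With [T_y = inf {t >= 1 | S(t) = y}], [first_passage t x y] is the
    probability that [T_y = t] for the chain started at [x]. *)
Fixpoint first_passage (t : nat) (x y : S) : \bar R :=
  match t with
  | 0 => 0
  | 1 => P x y
  | t'.+1 => \esum_(z in [set z | z <> y]) (P x z * first_passage t' z y)
  end.

Definition return_prob (x : S) : \bar R :=
  \sum_(0 <= t <oo) first_passage t x x.

(** This is the expectation of the return time as soon as the return time is
    almost surely finite, i.e. when [return_prob x = 1]. *)
Definition mean_return_time (x : S) : \bar R :=
  \sum_(0 <= t <oo) (t%:R%:E * first_passage t x x).

Definition positive_recurrent (x : S) : Prop :=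
  return_prob x = 1 /\ mean_return_time x < +oo.

End MarkovChain.

Section Matching.
Variables (R : realType) (n m : nat) (A : 'M[nat]_(n, m)).

(** [rule x i j (s, i')] is the probability that, in queue state [x] and
    internal state [i], an arrival of class [j] triggers the activations [s]
    and moves the internal state to [i']. *)
Record matching_policy := MatchingPolicy {
  istate : countType;
  istate0 : istate;
  rule : 'cV[nat]_n -> istate -> 'I_n -> 'cV[nat]_m * istate -> R;
  rule_ge0 : forall x i j d, 0 <= rule x i j d;
  rule_sum1 : forall x i j, \esum_(d in setT) (rule x i j d)%:E = 1%E;
  rule_feasible : forall x i j s i', 0 < rule x i j (s, i') ->
    forall c, ((A *m s)%R c ord0 <= (x + delta_mx j 0)%R c ord0)%N;
  rule_bounded : exists B : nat, forall x i j s i', 0 < rule x i j (s, i') ->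
    (\sum_k s k ord0 <= B)%N
}.

Definition chain_state (p : matching_policy) : choiceType :=
  ('cV[nat]_n * istate p)%type.

Definition empty_state (p : matching_policy) : chain_state p :=
  (0, istate0 p).

Variable lam : 'cV[R]_n.

Definition arrival_law (j : 'I_n) : R := lam j 0 / \sum_i lam i 0.

(** Transition probabilities of the embedded chain.  The next queue state
    [x + e_j - A s] equals [v.1] iff [v.1 + A s = x + e_j]; this form avoids
    truncated subtraction. *)
Definition transition (p : matching_policy) (u v : chain_state p) : \bar R :=
  (\sum_(j < n) ((arrival_law j)%:E *
     \esum_(s in [set s : 'cV[nat]_m | (v.1 + A *m s = u.1 + delta_mx j 0)%R])
        (rule u.1 u.2 j (s, v.2))%:E))%E.

Definition stable (p : matching_policy) : Prop :=
  forall u, communicates (@transition p) (empty_state p) u ->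
    positive_recurrent (@transition p) u.

Definition stabilizable : Prop := exists p : matching_policy, stable p.

End Matching.

Section Linear.
Variable R : realType.

Definition real_mx n m (A : 'M[nat]_(n, m)) : 'M[R]_(n, m) :=
  map_mx (fun k : nat => k%:R) A.

Definition dotp n (u v : 'cV[R]_n) : R := \sum_i u i 0 * v i 0.

Definition col_span n m (B : 'M[R]_(n, m)) : set 'cV[R]_n :=
  range (fun w : 'cV[R]_m => B *m w).

Definition surjective_mx n m (B : 'M[R]_(n, m)) : Prop :=
  col_span B = [set: 'cV[R]_n].

Definition cone n m (B : 'M[R]_(n, m)) : set 'cV[R]_n :=
  [set B *m w | w in [set w : 'cV[R]_m | forall k, 0 <= w k 0]].

Definition supp m (mu : 'cV[R]_m) : {set 'I_m} := [set k | mu k 0 != 0]%SET.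

Definition supp_cols n m (B : 'M[R]_(n, m)) (mu : 'cV[R]_m) :
    'M[R]_(n, #|supp mu|) :=
  colsub (fun k : 'I_#|supp mu| => enum_val k) B.

End Linear.

(* Main.v *)
(** (i) -> (ii): if [y] violates (ii), then [max 0 (- <y, X>)] is a nonnegative
    submartingale growing at most linearly in time, so [t * P(T > t)] stays
    bounded away from [0] for the return time [T] to the empty state, and [T]
    is not integrable.

    (iv) -> (i): activations are scheduled ahead of the arrivals and kept
    pending, in the internal state [D], until they become feasible.  The balance
    [Z = X - A D] is then a walk on the integer lattice with no sign constraint,
    and the activations can be chosen to give [|Z|^2] negative drift far from
    the origin and a positive chance of hitting [0] exactly from the vicinity of
    the origin.  As pending activations are performed greedily, no pending
    activation is ever feasible, so that [Z = 0] forces [D = 0] and [X = 0]. *)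

Require Import Defs.
From HB Require Import structures.
From mathcomp Require Import all_boot all_order all_algebra.
From mathcomp Require Import all_classical all_reals all_analysis.
From mathcomp Require Import ring lra zify.

Set Implicit Arguments.
Unset Strict Implicit.
Unset Printing Implicit Defensive.

Import Order.TTheory GRing.Theory Num.Theory.
Import numFieldNormedType.Exports.

Local Open Scope classical_set_scope.
Local Open Scope ring_scope.

(** * First passage times and drift criteria *)

(** The obstacle in (iv) -> (i) is exactness: a drift estimate brings the chain back to a bounded
    set, while positive recurrence needs a return to one state, and the columns of [A] need not
    generate the integer lattice. Arrivals do supply unit steps in every coordinate, but only
    upwards; so near the origin the balance is first pushed into the nonpositive orthant. Two bounds
    must survive. Pending activations may pile up, yet from a blocked state one arrival releases at
    most one more activation than are newly scheduled, so the number per epoch stays bounded. The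
    push grows with the radius [r], but the drift outside that radius concerns the threshold rule
    alone, so [r] can be chosen after the drift constants. In (i) -> (ii) the policy is arbitrary,
    and only the conservation law [X' + A s = X + e_j] is available. *)

Section Chain.
Variables (R : realType) (S : choiceType) (P : S -> S -> \bar R).
Hypothesis P_ge0 : forall x y, (0 <= P x y)%E.
Hypothesis P_sum1 : forall x, \esum_(z in setT) P x z = 1%E.
Local Open Scope ereal_scope.

Lemma esumZl (I : set S) (a : S -> \bar R) (r : R) : (0 <= r)%R ->
  (forall i, 0 <= a i) ->
  \esum_(i in I) (r%:E * a i) = r%:E * \esum_(i in I) a i.
Proof.
move=> r0 a0; rewrite /esum -ereal_supZl//.
  congr ereal_sup; apply/seteqP; split=> [_ [X XI <-]|_ [_ [X XI <-] <-]] /=.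
    by exists (\sum_(i \in X) a i); [exists X|rewrite ge0_mule_fsumr].
  by exists X => //; rewrite ge0_mule_fsumr.
by apply/set0P; exists (\sum_(i \in set0) a i); exists set0 => //; exact: fsets_set0.
Qed.

Lemma esum_split1 (e : S) (f : S -> \bar R) : (forall z, 0 <= f z) ->
  \esum_(z in setT) f z = f e + \esum_(z in [set z | z <> e]) f z.
Proof.
by move=> f0; rewrite (esumID [set e])// !setTI esum_set1.
Qed.

Lemma le_esum_term (I : set S) (f : S -> \bar R) (z : S) : I z ->
  (forall z, 0 <= f z) -> f z <= \esum_(z in I) f z.
Proof.
move=> Iz f0; rewrite (esumID [set z])// (_ : I `&` [set z] = [set z]).
  by rewrite esum_set1// leeDl// esum_ge0.
by apply/seteqP; split=> [x []//|x ->].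
Qed.

Lemma sub_esum (I J : set S) (f : S -> \bar R) : I `<=` J ->
  (forall z, 0 <= f z) -> \esum_(z in I) f z <= \esum_(z in J) f z.
Proof.
move=> IJ f0; rewrite [leRHS](esumID I)// (_ : J `&` I = I) ?leeDl ?esum_ge0//.
by apply/seteqP; split=> [x []//|x Ix]; split=> //; exact: IJ.
Qed.

(** Started at [x], [surv e t x] is the probability that the first passage
    time [T_e >= 1] exceeds [t], and [hit e t x] that it is at most [t]. *)
Fixpoint surv (e : S) (t : nat) (x : S) : \bar R :=
  if t is t'.+1 then \esum_(z in [set z | z <> e]) (P x z * surv e t' z) else 1.

Definition hit (e : S) (t : nat) (x : S) : \bar R :=
  \sum_(s < t) first_passage P s.+1 x e.

Lemma first_passage_ge0 t x y : 0 <= first_passage P t x y.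
Proof.
elim: t x => [|[|t] IH] x //=; apply: esum_ge0 => z _.
by apply: mule_ge0 => //; exact: IH.
Qed.

Lemma surv_ge0 e t x : 0 <= surv e t x.
Proof.
by elim: t x => [|t IH] x /=; [exact: lee01|apply: esum_ge0 => z _; apply: mule_ge0].
Qed.

Lemma hit_ge0 e t x : 0 <= hit e t x.
Proof. by apply: sume_ge0 => i _; exact: first_passage_ge0. Qed.

Lemma hitS e t x :
  hit e t.+1 x = P x e + \esum_(z in [set z | z <> e]) (P x z * hit e t z).
Proof.
rewrite /hit big_ord_recl /=; congr (_ + _).
rewrite -esum_sum; last first.
  by move=> z i _ _; apply: mule_ge0 => //; exact: (first_passage_ge0 i.+1).
apply: eq_esum => z _; rewrite ge0_sume_distrr//.
by move=> i _; exact: (first_passage_ge0 i.+1).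
Qed.

Lemma surv_hit e t x : surv e t x + hit e t x = 1.
Proof.
elim: t x => [|t IH] x; first by rewrite /hit big_ord0 adde0.
rewrite hitS /= addeCA -esumD; try by move=> *; rewrite mule_ge0 ?surv_ge0 ?hit_ge0.
under eq_esum do rewrite -ge0_muleDr ?surv_ge0 ?hit_ge0// IH mule1.
by rewrite -[RHS](P_sum1 x) (esum_split1 e).
Qed.

Lemma surv_le1 e t x : surv e t x <= 1.
Proof. by rewrite -(surv_hit e t x) leeDl// hit_ge0. Qed.

Lemma surv_fin e t x : surv e t x \is a fin_num.
Proof. by rewrite ge0_fin_numE ?surv_ge0// (le_lt_trans (surv_le1 _ _ _)) ?ltry. Qed.

Lemma hit_fin e t x : hit e t x \is a fin_num.
Proof.
rewrite ge0_fin_numE ?hit_ge0// (@le_lt_trans _ _ 1) ?ltry//.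
by rewrite -(surv_hit e t x) leeDr// surv_ge0.
Qed.

Lemma hit_stepE e t x : hit e t.+1 x =
  \esum_(z in setT) (P x z * (if z == e then 1 else hit e t z)).
Proof.
rewrite hitS (esum_split1 e) ?eqxx ?mule1; last first.
  by move=> z; apply: mule_ge0 => //; case: ifP => // _; exact: hit_ge0.
by congr (_ + _); apply: eq_esum => z /= /eqP/negbTE ->.
Qed.

Lemma hit_recr e t x : hit e t.+1 x = hit e t x + first_passage P t.+1 x e.
Proof. by rewrite /hit big_ord_recr. Qed.

Lemma first_passage_surv e t x :
  first_passage P t.+1 x e + surv e t.+1 x = surv e t x.
Proof.
have h := surv_hit e t.+1 x.
have fp : first_passage P t.+1 x e \is a fin_num.
  rewrite ge0_fin_numE ?first_passage_ge0//.
  have : hit e t.+1 x < +oo by rewrite -ge0_fin_numE ?hit_ge0 ?hit_fin.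
  by apply: le_lt_trans; rewrite hit_recr leeDr ?hit_ge0.
have := surv_hit e t x; rewrite -[in RHS]h hit_recr.
rewrite -(fineK fp) -(fineK (surv_fin e t x)) -(fineK (surv_fin e t.+1 x)).
rewrite -(fineK (hit_fin e t x)) -!EFinD => -[].
by move=> E; congr (_%:E); lra.
Qed.

Definition rsurv e t := fine (surv e t e).
Definition rfp e t := fine (first_passage P t e e).

Lemma rsurvE e t : surv e t e = (rsurv e t)%:E.
Proof. by rewrite fineK ?surv_fin. Qed.

Lemma rfpE e t : first_passage P t e e = (rfp e t)%:E.
Proof.
rewrite fineK//; case: t => [|t]//.
rewrite ge0_fin_numE ?first_passage_ge0// (@le_lt_trans _ _ (surv e t e)) //.
  by rewrite -first_passage_surv leeDl// surv_ge0.
by rewrite -ge0_fin_numE ?surv_ge0 ?surv_fin.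
Qed.

Lemma rfp_rsurv e t : (rsurv e t = rsurv e t.+1 + rfp e t.+1)%R.
Proof.
by apply: EFin_inj; rewrite EFinD -!rsurvE -rfpE addeC first_passage_surv.
Qed.

Lemma rsurv_ge0 e t : (0 <= rsurv e t)%R.
Proof. by apply: fine_ge0; exact: surv_ge0. Qed.

Lemma rfp_ge0 e t : (0 <= rfp e t)%R.
Proof. by apply: fine_ge0; exact: first_passage_ge0. Qed.

Lemma sum_rfp e N : (\sum_(0 <= t < N.+1) rfp e t = 1 - rsurv e N)%R.
Proof.
elim: N => [|N IH]; first by rewrite big_nat1 /rfp /rsurv /= subrr.
by rewrite big_nat_recr //= IH (rfp_rsurv e N); ring.
Qed.

(** Summation by parts: both sides are the expectation of [min(T_e, N)] from [e]. *)
Lemma sum_rfp_mean e N :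
  (\sum_(0 <= t < N.+1) t%:R * rfp e t + N%:R * rsurv e N
   = \sum_(0 <= t < N) rsurv e t)%R.
Proof.
elim: N => [|N IH]; first by rewrite big_nat1 big_geq// !mul0r addr0.
rewrite big_nat_recr //= [RHS]big_nat_recr //= -IH (rfp_rsurv e N) -natr1; ring.
Qed.

(** By induction on [t], [h] dominates the partial sums of [P(T_e > t)], hence
    the expected first passage time. *)
Lemma foster_point e (h : S -> \bar R) : (forall x, 0 <= h x) -> h e < +oo ->
  (forall x, 1 + \esum_(z in [set z | z <> e]) (P x z * h z) <= h x) ->
  positive_recurrent P e.
Proof.
move=> h0 hfin hP.
have sum_le N x : \sum_(t < N) surv e t x <= h x.
  elim: N x => [|N IH] x; first by rewrite big_ord0.
  rewrite big_ord_recl /= (le_trans _ (hP x))// leeD2l//.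
  rewrite -esum_sum; last first.
    by move=> z i _ _; apply: mule_ge0 => //; exact: surv_ge0.
  apply: le_esum => z _.
  rewrite -ge0_sume_distrr; last by move=> *; exact: surv_ge0.
  exact: lee_wpmul2l.
have hR : h e = (fine (h e))%:E by rewrite fineK// ge0_fin_numE.
have sumR N : (\sum_(0 <= t < N) rsurv e t <= fine (h e))%R.
  rewrite -lee_fin -hR big_mkord -sumEFin (le_trans _ (sum_le N e))//.
  by apply: lee_sum => i _; rewrite rsurvE.
split.
- have rle1 : return_prob P e <= 1.
    apply: lime_le; first by apply: is_cvg_nneseries => *; exact: first_passage_ge0.
    apply: nearW => -[|N]; first by rewrite big_geq// lee01.
    rewrite (eq_bigr (fun t => (rfp e t)%:E)); last by move=> *; rewrite rfpE.
    by rewrite sumEFin sum_rfp lee_fin gerBl rsurv_ge0.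
  have rge N : (1 - rsurv e N)%:E <= return_prob P e.
    rewrite -sum_rfp -sumEFin (eq_bigr (fun t => first_passage P t e e)); last first.
      by move=> *; rewrite rfpE.
    by apply: nneseries_lim_ge => *; exact: first_passage_ge0.
  have rfin : return_prob P e \is a fin_num.
    rewrite ge0_fin_numE ?(le_lt_trans rle1) ?ltry//.
    by apply: nneseries_ge0 => *; exact: first_passage_ge0.
  move: rle1 rge; rewrite -(fineK rfin); set r := fine _ => rle1 rge.
  congr (_%:E); apply/eqP; rewrite eq_le -lee_fin rle1 /= leNgt; apply/negP => r1.
  have eps0 : (0 < 1 - r)%R by rewrite subr_gt0.
  (* A defect [1 - r] would bound every survival probability from below, so [N] of them would exceed
     [h e]. *)
  pose N := (Num.truncn (fine (h e) / (1 - r))).+1.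
  have : (fine (h e) < N%:R * (1 - r))%R.
    by rewrite -ltr_pdivrMr// truncnS_gt.
  rewrite ltNge => /negP; apply; apply: le_trans (sumR N).
  rewrite mulr_natl -[X in (_ *+ X <= _)%R](subn0 N) -sumr_const_nat.
  by apply: ler_sum => t _; have := rge t; rewrite lee_fin; lra.
- apply: (@le_lt_trans _ _ (h e)) => //; apply: lime_le.
    apply: is_cvg_nneseries => t _ _.
    by apply: mule_ge0; [rewrite lee_fin|exact: first_passage_ge0].
  apply: nearW => -[|N]; first by rewrite big_geq.
  rewrite (eq_bigr (fun t => (t%:R * rfp e t)%:E)); last first.
    by move=> t _; rewrite rfpE EFinM.
  rewrite sumEFin hR lee_fin (le_trans _ (sumR N))// -sum_rfp_mean lerDl.
  by rewrite mulr_ge0// rsurv_ge0.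
Qed.

(** For an almost surely finite return time, [N * P(T_e > N)] is at most the tail of the mean series
    beyond [N], which tends to [0]. *)
Lemma positive_recurrent_surv e (c : R) : (0 < c)%R -> positive_recurrent P e ->
  exists N, (N.+1%:R * rsurv e N.+1 < c)%R.
Proof.
move=> c0 [rp mrt]; apply: contrapT => /forallNP H.
have {}H N : (c <= N.+1%:R * rsurv e N.+1)%R by rewrite leNgt; apply/negP/H.
have mge0 t : 0 <= t%:R%:E * first_passage P t e e.
  by apply: mule_ge0; [rewrite lee_fin|exact: first_passage_ge0].
have Mfin : mean_return_time P e \is a fin_num.
  by rewrite ge0_fin_numE//; apply: nneseries_ge0.
pose G N := (\sum_(0 <= t < N.+1) t%:R * rfp e t)%R.
have GE N : \sum_(0 <= t < N.+1) t%:R%:E * first_passage P t e e = (G N)%:E.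
  by rewrite /G -sumEFin; apply: eq_bigr => t _; rewrite rfpE EFinM.
have Gle N : (G N <= fine (mean_return_time P e))%R.
  by rewrite -lee_fin fineK// -GE; apply: nneseries_lim_ge.
have [N GN] : exists N, (fine (mean_return_time P e) - c / 3 < G N)%R.
  apply: contrapT => /forallNP h.
  suff : mean_return_time P e <= (fine (mean_return_time P e) - c / 3)%:E.
    by rewrite -{1}(fineK Mfin) lee_fin; lra.
  apply: lime_le; first exact: is_cvg_nneseries.
  apply: nearW => -[|N].
    rewrite big_geq// (le_trans (y := (G 0%N)%:E))//.
      by rewrite lee_fin /G big_nat1 mul0r.
    by rewrite lee_fin leNgt; apply/negP/h.
  by rewrite GE lee_fin leNgt; apply/negP/h.
have GS M : (G M.+1 = G M + M.+1%:R * rfp e M.+1)%R by rewrite /G big_nat_recr.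
have {}GN : (fine (mean_return_time P e) - c / 3 < G N.+1)%R.
  by rewrite GS (lt_le_trans GN)// lerDl mulr_ge0// rfp_ge0.
have tail K : (N.+1%:R * (rsurv e N.+1 - rsurv e (N.+1 + K)) <= G (N.+1 + K)%N - G N.+1)%R.
  elim: K => [|K IH]; first by rewrite !addn0 !subrr mulr0.
  rewrite addnS GS; have := rfp_rsurv e (N.+1 + K).
  have := rfp_ge0 e (N.+1 + K).+1.
  have : (N.+1%:R <= (N.+1 + K).+1%:R :> R)%R by rewrite ler_nat; lia.
  move: IH; set a := rsurv _ (_ + _); set b := rsurv _ (_ + _).+1.
  set f := rfp _ _; move=> IH le f0 ab; rewrite ab in IH.
  by have := ler_wpM2r f0 le; nra.
(* This removes the truncation at [N.+1 + K]: a survival probability staying above [d] would cap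
   [return_prob] at [1 - d]. *)
have [K hK] : exists K, (N.+1%:R * rsurv e (N.+1 + K) < c / 3)%R.
  apply: contrapT => /forallNP h.
  have {}h K : (c / 3 / N.+1%:R <= rsurv e (N.+1 + K))%R.
    by rewrite ler_pdivrMr// [leRHS]mulrC leNgt; apply/negP/h.
  set d := (c / 3 / N.+1%:R)%R in h.
  have d0 : (0 < d)%R by rewrite !divr_gt0.
  have : return_prob P e <= (1 - d)%:E.
    apply: lime_le; first by apply: is_cvg_nneseries => *; exact: first_passage_ge0.
    exists (N.+2) => // -[//|M] /= NM.
    rewrite (eq_bigr (fun t => (rfp e t)%:E)); last by move=> *; rewrite rfpE.
    rewrite sumEFin sum_rfp lee_fin.
    by have := h (M - N.+1)%N; rewrite subnKC//; lra.
  by rewrite rp lee_fin; lra.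
have := tail K; have := Gle (N.+1 + K)%N; have := H N; rewrite mulrBr; lra.
Qed.

(** A drift condition in which the positive drift allowed at [x] is paid for by
    the probability of hitting [e] within [N] steps. *)
Lemma foster_hit e (V : S -> \bar R) (K : R) (N : nat) : (0 <= K)%R ->
  (forall x, 0 <= V x) ->
  (forall x, 1 + (K%:E * surv e N x + \esum_(z in setT) (P x z * V z))
             <= V x + K%:E) ->
  exists H : S -> \bar R, [/\ forall x, 0 <= H x,
    forall x, (V x < +oo -> H x < +oo) &
    forall x, 1 + \esum_(z in [set z | z <> e]) (P x z * H z) <= H x].
Proof.
move=> K0 V0 hV.
(* [W x] is the expectation of [min(T_e, N)]. One step killed at [e] changes it by [surv e N x - 1],
   so adding [K * W] to [V] absorbs the allowance [K * (1 - surv e N x)]. *)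
pose W x := \sum_(j < N) surv e j x.
have W0 x : 0 <= W x by apply: sume_ge0 => *; exact: surv_ge0.
have Wfin x : W x \is a fin_num by apply/sum_fin_numP => *; exact: surv_fin.
have KE x : 0 <= K%:E * W x by apply: mule_ge0; rewrite ?lee_fin.
exists (fun x => V x + K%:E * W x); split.
- by move=> x; apply: adde_ge0.
- move=> x Vx; apply: lte_add_pinfty => //.
  by rewrite -ge0_fin_numE// fin_numM//.
- move=> x; rewrite -(@leeD2rE _ K%:E)//.
  under eq_esum do rewrite ge0_muleDr// muleCA.
  rewrite esumD; try by move=> *; repeat apply: mule_ge0; rewrite ?lee_fin.
  rewrite esumZl//; last by move=> *; apply: mule_ge0.
  have WS : \esum_(z in [set z | z <> e]) (P x z * W z) + 1 = W x + surv e N x.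
    have -> : W x + surv e N x = \sum_(j < N.+1) surv e j x by rewrite big_ord_recr.
    rewrite big_ord_recl /= addeC; congr (_ + _).
    rewrite -esum_sum; last by move=> *; rewrite mule_ge0 ?surv_ge0.
    by apply: eq_esum => z _; rewrite ge0_sume_distrr// => *; exact: surv_ge0.
  have -> : forall a b : \bar R, 0 <= a -> 0 <= b -> 1 + (a + K%:E * b) + K%:E
     = 1 + (K%:E * (b + 1) + a).
    move=> a b a0 b0; rewrite ge0_muleDr// mule1 -!addeA; congr (_ + _).
    by rewrite addeC -addeA.
  2,3: by apply: esum_ge0 => *; apply: mule_ge0.
  rewrite WS ge0_muleDr ?surv_ge0//.
  rewrite (addeC (K%:E * W x)) (addeAC (K%:E * surv e N x)) addeA.
  rewrite [leRHS]addeAC leeD2r// (le_trans _ (hV x))//.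
  rewrite leeD2l// leeD2l// sub_esum// => z; exact: mule_ge0.
Qed.

Lemma accessible_hit u t x : nstep P t x u > 0 -> x <> u -> 0 < hit u t x.
Proof.
elim: t x => [|t IH] x /=.
  by case: eqP => // _; rewrite ltxx.
move=> h xu; rewrite hit_stepE lt_neqAle eq_sym.
have ge0 z : 0 <= P x z * (if z == u then 1 else hit u t z).
  by apply: mule_ge0 => //; case: ifP => _ //; exact: hit_ge0.
rewrite esum_ge0// andbT; apply: contraTneq h => h0.
rewrite -leNgt le_eqVlt; apply/orP; left; apply/eqP.
apply: esum1 => z _; have := le_esum_term (I := setT) (z := z) I ge0; rewrite h0 => le0.
have {}le0 : P x z * (if z == u then 1 else hit u t z) = 0.
  by apply/eqP; rewrite eq_le le0 ge0.
move/eqP: le0; rewrite mule_eq0 => /orP[/eqP ->|]; first by rewrite mul0e.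
case: (z =P u) => [_|zu /eqP hz]; first by rewrite gt_eqF// lte_fin ltr01.
case: (ltP 0 (nstep P t z u)) => [/IH|le0]; first by rewrite hz ltxx => /(_ zu).
suff -> : nstep P t z u = 0 by rewrite mule0.
apply/eqP; rewrite eq_le le0 /=.
elim: (t) z {hz IH le0 zu} => [|s IHs] z /=; first by case: ifP.
by apply: esum_ge0 => w _; apply: mule_ge0.
Qed.

(** [H] may be infinite at some states. Finiteness spreads along transitions of positive
    probability, since an infinite term would make the drift inequality fail; steps into [e] are
    covered by [H e < +oo]. *)
Lemma nstep_lty (e u : S) (H : S -> \bar R) t x : (forall x, 0 <= H x) -> H e < +oo ->
  (forall x, 1 + \esum_(z in [set z | z <> e]) (P x z * H z) <= H x) ->
  nstep P t x u > 0 -> H x < +oo -> H u < +oo.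
Proof.
move=> H0 He hH; elim: t x => [|t IH] x /=.
  by case: eqP => [->|]; rewrite ?ltxx.
move=> h Hx; apply: contrapT => Hu; move: h; rewrite esum1 ?ltxx// => z _.
case: (ltP 0 (P x z)) => [Pz|Pz]; last first.
  suff -> : P x z = 0 by rewrite mul0e.
  by apply/eqP; rewrite eq_le Pz P_ge0.
have Hz : H z < +oo.
  case: (z =P e) => [->//|ze]; rewrite ltNge leye_eq; apply/negP => /eqP Hz.
  have : P x z * H z <= \esum_(z in [set z | z <> e]) (P x z * H z).
    by apply: (@le_esum_term _ (fun z => P x z * H z)) => // w; apply: mule_ge0.
  rewrite Hz gt0_muley// leye_eq => /eqP E.
  by move: (hH x); rewrite E addey// leye_eq => /eqP E'; rewrite E' ltxx in Hx.
case: (ltP 0 (nstep P t z u)) => [/IH/(_ Hz)//|le0].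
suff -> : nstep P t z u = 0 by rewrite mule0.
apply/eqP; rewrite eq_le le0 /=.
elim: (t) z {IH le0 Pz Hz} => [|s IHs] z /=; first by case: ifP.
by apply: esum_ge0 => w _; apply: mule_ge0.
Qed.

(** A function [H] as in [foster_point] for [e] has drift at most [P x e * H e]
    towards any other target [u], which the chance of going through [e] and then
    hitting [u] pays for. *)
Lemma foster_class (e : S) (H : S -> \bar R) : (forall x, 0 <= H x) -> H e < +oo ->
  (forall x, 1 + \esum_(z in [set z | z <> e]) (P x z * H z) <= H x) ->
  forall u, accessible P e u -> positive_recurrent P u.
Proof.
move=> H0 He hH u [t etu].
have Hu := nstep_lty H0 He hH etu He.
case: (u =P e) => [->|ue]; first exact: foster_point hH.
have eu : e <> u by move=> E; apply: ue.
have hit0 := accessible_hit etu eu.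
have HeR : (fine (H e))%:E = H e by rewrite fineK// ge0_fin_numE.
have pR : (fine (hit u t e))%:E = hit u t e by rewrite fineK// hit_fin.
set p := fine _ in pR; set c := fine _ in HeR.
have p0 : (0 < p)%R by rewrite -lte_fin pR.
have c0 : (0 <= c)%R by rewrite -lee_fin HeR.
(* [hit u t.+1 x] is at least [P x e * p]; the weight [c / p] turns this into [P x e * H e], the
   term that [hH] leaves out. *)
have [||V [V0 Vfin hV]] := @foster_hit u H (c / p) t.+1 _ H0.
- by rewrite divr_ge0// ltW.
- move=> x; rewrite (esum_split1 e); last by move=> z; apply: mule_ge0.
  apply: (@le_trans _ _ ((1 + \esum_(z in [set z | z <> e]) (P x z * H z)) + (c / p)%:E)).
    rewrite [X in 1 + X]addeA [X in 1 + X]addeC [leLHS]addeA leeD2l//.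
    have pe : P x e * hit u t e <= hit u t.+1 x.
      rewrite hit_stepE.
      have := @le_esum_term setT (fun z => P x z * (if z == u then 1 else hit u t z)) e I.
      rewrite (negbTE (introN eqP eu)); apply => z.
      by apply: mule_ge0 => //; case: ifP => // _; exact: hit_ge0.
    have Pfin : P x e \is a fin_num.
      rewrite ge0_fin_numE// (@le_lt_trans _ _ 1) ?ltry// -(P_sum1 x).
      by apply: (@le_esum_term setT (P x)).
    have := surv_hit u t.+1 x; move: pe.
    rewrite -(fineK Pfin) -pR -HeR -(fineK (surv_fin _ _ _)) -(fineK (hit_fin _ _ _)).
    rewrite -!EFinM -!EFinD !lee_fin => pe [sh].
    have -> : fine (surv u t.+1 x) = (1 - fine (hit u t.+1 x))%R by lra.
    have cp : (0 <= c / p)%R by rewrite divr_ge0// ltW.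
    have := ler_wpM2l cp pe.
    have -> : (c / p * (fine (P x e) * p) = fine (P x e) * c)%R by field; rewrite gt_eqF.
    lra.
  by rewrite leeD2r.
exact: (foster_point V0 (Vfin _ Hu) hV).
Qed.

(** A nonnegative submartingale vanishing at [e] and growing at most linearly
    would force [t * P(T_e > t)] to stay bounded away from [0]. *)
Lemma submartingale_not_positive_recurrent (e : S) (f : S -> \bar R) (l : S -> nat)
    (L c : R) : (0 < L)%R -> (0 < c)%R ->
  (forall x, 0 <= f x) -> f e = 0 -> l e = 0%N ->
  (forall x z, 0 < P x z -> (l z <= (l x).+1)%N) ->
  (forall x, f x <= (L * (l x)%:R)%:E) ->
  (forall x, f x <= \esum_(z in setT) (P x z * f z)) ->
  c%:E <= \esum_(z in setT) (P e z * f z) ->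
  ~ positive_recurrent P e.
Proof.
move=> L0 c0 f0 fe le lP fl fsub fc.
have esumT x : \esum_(z in setT) (P x z * f z) =
               \esum_(z in [set z | z <> e]) (P x z * f z).
  rewrite (esum_split1 e) ?fe ?mule0 ?add0e// => z; exact: mule_ge0.
(* [M t x] is the mean of [f] at time [t] on the event that [e] is avoided at times [1] to [t]. As
   [f e = 0], killing at [e] costs nothing, and [M] is nondecreasing in [t]. *)
pose M := fix M t x := if t is t'.+1
  then \esum_(z in [set z | z <> e]) (P x z * M t' z) else f x.
have M0 t x : 0 <= M t x.
  by elim: t x => [|t IH] x //=; apply: esum_ge0 => z _; apply: mule_ge0.
have MS t x : M t x <= M t.+1 x.
  elim: t x => [|t IH] x; first by rewrite /= -esumT.
  by apply: le_esum => z _; apply: lee_wpmul2l => //; exact: IH.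
have Mc t : c%:E <= M t.+1 e.
  by elim: t => [|t IH]; [rewrite /= -esumT|exact: (le_trans IH)].
have Ml t x : M t x <= (L * (l x + t)%:R)%:E * surv e t x.
  elim: t x => [|t IH] x; first by rewrite /= addn0 mule1.
  rewrite /= -esumZl; last 2 first.
  - by rewrite mulr_ge0// ltW.
  - by move=> z; rewrite mule_ge0 ?surv_ge0.
  apply: le_esum => z _; case: (ltP 0 (P x z)) => Pz; last first.
    suff -> : P x z = 0 by rewrite !mul0e mule0.
    by apply/eqP; rewrite eq_le Pz P_ge0.
  rewrite muleCA lee_wpmul2l//; apply: (le_trans (IH z)).
  rewrite lee_wpmul2r ?surv_ge0// lee_fin ler_pM2l// ler_nat.
  by have := lP _ _ Pz; lia.
move=> /(positive_recurrent_surv (c := (c / L)%R))[|N]; first by rewrite divr_gt0.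
rewrite ltNge => /negP; apply; rewrite ler_pdivrMr//.
have := le_trans (Mc N) (Ml N.+1 e); rewrite le add0n rsurvE -EFinM lee_fin.
lra.
Qed.

End Chain.

(** * Farkas' lemma and the cone conditions *)

Section LinearAlgebra.
Variable R : realType.
Implicit Types n m : nat.

Lemma dotpDl n (u v w : 'cV[R]_n) : dotp (u + v) w = dotp u w + dotp v w.
Proof. by rewrite /dotp -big_split; apply: eq_bigr => i _; rewrite mxE mulrDl. Qed.

Lemma dotpC n (u v : 'cV[R]_n) : dotp u v = dotp v u.
Proof. by apply: eq_bigr => i _; rewrite mulrC. Qed.

Lemma dotpDr n (u v w : 'cV[R]_n) : dotp u (v + w) = dotp u v + dotp u w.
Proof. by rewrite !(dotpC u) dotpDl. Qed.

Lemma dotpZl n a (u v : 'cV[R]_n) : dotp (a *: u) v = a * dotp u v.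
Proof. by rewrite /dotp mulr_sumr; apply: eq_bigr => i _; rewrite mxE mulrA. Qed.

Lemma dotpZr n a (u v : 'cV[R]_n) : dotp u (a *: v) = a * dotp u v.
Proof. by rewrite !(dotpC u) dotpZl. Qed.

Lemma dotpNr n (u v : 'cV[R]_n) : dotp u (- v) = - dotp u v.
Proof. by rewrite -scaleN1r dotpZr mulN1r. Qed.

Lemma dotpNl n (u v : 'cV[R]_n) : dotp (- u) v = - dotp u v.
Proof. by rewrite -scaleN1r dotpZl mulN1r. Qed.

Lemma dotp_eq0 n (b : 'cV[R]_n) : (forall y, 0 <= dotp y b) -> b = 0.
Proof.
move=> h; apply/matrixP => i j; rewrite ord1 mxE.
have := h (- b); rewrite dotpNl oppr_ge0 => le.
have b2 : dotp b b = \sum_k b k 0 ^+ 2 by apply: eq_bigr => k _; rewrite expr2.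
have : \sum_k b k 0 ^+ 2 == 0.
  by rewrite eq_le -b2 le b2 sumr_ge0// => k _; exact: sqr_ge0.
rewrite psumr_eq0 => [/allP /(_ i)|k _]; last exact: sqr_ge0.
by rewrite mem_index_enum => /(_ isT) /=; rewrite sqrf_eq0 => /eqP.
Qed.

(** Bartl's induction: if the last inequality is not redundant, some [y0]
    violates it alone, and projecting along [y0] removes it. *)
Lemma farkas n m (a : nat -> 'cV[R]_n) (b : 'cV[R]_n) :
  (forall y, (forall i, (i < m)%N -> 0 <= dotp y (a i)) -> 0 <= dotp y b) ->
  exists2 nu : nat -> R, (forall i, 0 <= nu i) & b = \sum_(i < m) nu i *: a i.
Proof.
elim: m a b => [|m IH] a b h.
  by exists (fun=> 0) => //; rewrite big_ord0; apply: dotp_eq0 => y; exact: h.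
have [/IH[nu nu0 ->]|] := pselect (forall y,
    (forall i, (i < m)%N -> 0 <= dotp y (a i)) -> 0 <= dotp y b).
  exists (fun i => if (i < m)%N then nu i else 0); first by move=> i; case: ifP.
  rewrite big_ord_recr /= ltnn scale0r addr0.
  by apply: eq_bigr => i _; rewrite ltn_ord.
move=> /existsNP[y /not_implyP[ya /negP]]; rewrite -ltNge => yb.
have ym : dotp y (a m) < 0.
  rewrite ltNge; apply/negP => ym; move: yb; rewrite ltNge => /negP; apply; apply: h.
  by move=> i; rewrite ltnS leq_eqVlt => /predU1P[->|/ya].
pose c := - (dotp y (a m))^-1; have c0 : 0 < c by rewrite oppr_gt0 invr_lt0.
pose y0 := c *: y.
have y0m : dotp y0 (a m) = -1.
  by rewrite dotpZl /c mulNr mulVf// lt_eqF.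
have y0a i : (i < m)%N -> 0 <= dotp y0 (a i).
  by move=> /ya; rewrite dotpZl => ?; rewrite mulr_ge0// ltW.
have y0b : dotp y0 b < 0 by rewrite dotpZl pmulr_rlt0.
clearbody y0.
(* The projection along [a m] onto the kernel of [y0]. Its adjoint sends every [z] to a vector
   orthogonal to [a m], so the last inequality holds trivially. *)
pose pr (v : 'cV[R]_n) := v + dotp y0 v *: a m.
have prE z v : dotp z (pr v) = dotp (z + dotp z (a m) *: y0) v.
  by rewrite dotpDr dotpZr dotpDl dotpZl [in RHS]mulrC.
have [|nu nu0 E] := IH (fun i => pr (a i)) (pr b).
  move=> z za; rewrite prE; apply: h => i.
  rewrite ltnS leq_eqVlt => /predU1P[->|im]; last by rewrite -prE za.
  by rewrite dotpDl dotpZl y0m mulrN1 subrr.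
pose d := \sum_(i < m) nu i * dotp y0 (a i) - dotp y0 b.
exists (fun i => if (i < m)%N then nu i else d).
  move=> i; case: ifP => // _; rewrite subr_ge0 (le_trans (ltW y0b))//.
  by apply: sumr_ge0 => j _; rewrite mulr_ge0// y0a.
rewrite big_ord_recr /= ltnn.
under eq_bigr do rewrite ltn_ord.
have -> : b = pr b - dotp y0 b *: a m by rewrite addrK.
rewrite E /d scalerBl addrA; congr (_ - _).
rewrite scaler_suml -big_split; apply: eq_bigr => i _.
by rewrite scalerDr scalerA.
Qed.

Lemma surjective_mxP n m (B : 'M[R]_(n, m)) :
  surjective_mx B <-> exists C, B *m C = 1%:M.
Proof.
split=> [sB|[C BC]].
  have /choice[w hw] (i : 'I_n) : exists w : 'cV[R]_m, B *m w = col i 1%:M.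
    have : [set: 'cV[R]_n] (col i 1%:M) by [].
    by rewrite -sB => -[w _ <-]; exists w.
  exists (\matrix_(k, i) w i k 0); apply/matrixP => i j.
  have /matrixP/(_ i 0) := hw j; rewrite !mxE => <-.
  by apply: eq_bigr => k _; rewrite !mxE.
by apply/seteqP; split=> // d _; exists (C *m d) => //; rewrite mulmxA BC mul1mx.
Qed.

Lemma mulmx_sum_colE n m (B : 'M[R]_(n, m)) (w : 'cV[R]_m) :
  B *m w = \sum_k w k 0 *: col k B.
Proof.
apply/matrixP => i j; rewrite !mxE summxE ord1.
by apply: eq_bigr => k _; rewrite !mxE mulrC.
Qed.

Lemma dotp_mulmx n m (B : 'M[R]_(n, m)) (w : 'cV[R]_m) (y : 'cV[R]_n) :
  dotp y (B *m w) = \sum_k w k 0 * dotp y (col k B).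
Proof.
rewrite /dotp; under [in RHS]eq_bigr do rewrite mulr_sumr.
rewrite exchange_big; apply: eq_bigr => /= i _.
by rewrite mxE mulr_sumr; apply: eq_bigr => k _; rewrite mxE; ring.
Qed.

Lemma supp_colsE n m (B : 'M[R]_(n, m)) (mu w : 'cV[R]_m) :
  (forall k, k \notin supp mu -> w k 0 = 0) ->
  supp_cols B mu *m (\col_j w (enum_val j) 0) = B *m w.
Proof.
move=> w0; apply/matrixP => i j; rewrite !mxE ord1.
rewrite (bigID (fun k => k \in supp mu)) /= [X in _ + X]big1 ?addr0; last first.
  by move=> k /w0 ->; rewrite mulr0.
rewrite [RHS]big_enum_val.
by apply: eq_bigr => k _; rewrite !mxE.
Qed.

Lemma pos_lower_bound m (f : 'I_m -> R) : (forall k, 0 < f k) ->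
  exists2 d, 0 < d & forall k, d <= f k.
Proof.
move=> f0; have s0 : 0 <= \sum_k (f k)^-1 by apply: sumr_ge0 => k _; rewrite invr_ge0 ltW.
exists (\sum_k (f k)^-1 + 1)^-1; first by rewrite invr_gt0 ltr_wpDl.
move=> k; rewrite -[leRHS]invrK lef_pV2 ?posrE ?invr_gt0 ?ltr_wpDl//.
rewrite (bigD1 k)//= -addrA lerDl addr_ge0// sumr_ge0// => j _.
by rewrite invr_ge0 ltW.
Qed.

End LinearAlgebra.

(** * From the dual condition to the cone and support conditions *)

Section Conditions.
Variables (R : realType) (n m : nat) (n_gt0 : (0 < n)%N).
Variables (A : 'M[nat]_(n, m)) (A_neq0 : forall k, col k A != 0).
Variables (lam : 'cV[R]_n) (lam_gt0 : forall i, 0 < lam i 0).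
Local Notation rA := (real_mx R A).

Definition dual_condition := forall y : 'cV[R]_n, y != 0 ->
  (forall k, 0 <= dotp y (col k rA)) -> 0 < dotp y lam.

(** If [y] were nonzero and orthogonal to all columns, the condition would apply to both [y] and
    [- y]. *)
Lemma dual_surjective : dual_condition -> surjective_mx rA.
Proof.
move=> dual; apply/surjective_mxP/row_freeP; rewrite -kermx_eq0.
apply: contraT => /rowV0Pn[y /sub_kermxP yA y0].
have yk k : dotp y^T (col k rA) = 0.
  have /matrixP/(_ 0 k) := yA; rewrite !mxE => <-.
  by apply: eq_bigr => i _; rewrite !mxE.
have yT : y^T != 0 by rewrite -(inj_eq trmx_inj) trmxK trmx0.
have h1 := dual _ yT; have := dual (- y^T).
rewrite oppr_eq0 dotpNl oppr_gt0 => /(_ yT) h2.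
have := lt_trans (h1 _) (h2 _); rewrite ltxx; apply=> k; rewrite ?dotpNl yk ?oppr0//.
Qed.

(** Farkas' lemma for the columns and [- lam] puts [- A_k] in their cone; the
    coefficient of [- lam] cannot vanish since [A_k] is nonzero and nonnegative. *)
Lemma dual_positive_coordinate (k : 'I_m) : dual_condition ->
  exists mu : 'cV[R]_m, [/\ forall l, 0 <= mu l 0, 0 < mu k 0 & rA *m mu = lam].
Proof.
move=> dual.
pose a (i : nat) := if insub i is Some l then col l rA else - lam : 'cV[R]_n.
have aE (l : 'I_m) : a l = col l rA by rewrite /a valK.
have am : a m = - lam by rewrite /a insubF// ltnn.
have [y ya|nu nu0] := @farkas R n m.+1 a (- col k rA).
  rewrite dotpNr oppr_ge0; have [->|y0] := eqVneq y 0.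
    by rewrite /dotp big1// => i _; rewrite mxE mul0r.
  have : 0 < dotp y lam.
    by apply: dual => // l; rewrite -aE; apply: ya; rewrite ltnS ltnW.
  have := ya m (ltnSn m); rewrite am dotpNr oppr_ge0 => le /lt_le_trans/(_ le).
  by rewrite ltxx.
rewrite big_ord_recr /= am scalerN => E.
have {}E : nu m *: lam = col k rA + \sum_(l < m) nu l *: col l rA.
  rewrite (eq_bigr (fun l : 'I_m => nu l *: a l)); last by move=> l _; rewrite aE.
  by rewrite -[col k rA]opprK E opprB subrK.
have num : 0 < nu m.
  rewrite lt_def nu0 andbT; apply/negP => /eqP num0.
  move: E; rewrite num0 scale0r => E.
  move/eqP: (A_neq0 k); apply; apply/matrixP => i j; rewrite ord1 !mxE.
  have /matrixP/(_ i 0) := E; rewrite !mxE summxE => /esym/eqP.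
  rewrite paddr_eq0 ?ler0n//; first by rewrite pnatr_eq0 => /andP[/eqP].
  by apply: sumr_ge0 => l _; rewrite !mxE mulr_ge0.
exists ((nu m)^-1 *: (\col_l (nu l) + delta_mx k 0)); split.
- by move=> l; rewrite !mxE mulr_ge0 ?addr_ge0 ?ler0n ?invr_ge0 ?(ltW num).
- by rewrite !mxE !eqxx mulr_gt0 ?invr_gt0// ltr_wpDl.
- rewrite -scalemxAr mulmxDr -colE mulmx_sum_colE.
  under eq_bigr do rewrite mxE.
  by rewrite addrC -E scalerA mulVf ?scale1r// gt_eqF.
Qed.

(** Averages, over [k], solutions that are positive at coordinate [k]. *)
Lemma dual_positive_solution : dual_condition ->
  exists mu : 'cV[R]_m, (forall k, 0 < mu k 0) /\ rA *m mu = lam.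
Proof.
move=> dual; have [C AC] := (surjective_mxP _).1 (dual_surjective dual).
have m0 : (0 < m)%N.
  rewrite lt0n; apply/eqP => m0; have /matrixP/(_ (Ordinal n_gt0) (Ordinal n_gt0)) := AC.
  rewrite !mxE big1 => [/eqP|k _]; first by rewrite eqxx eq_sym oner_eq0.
  by have := ltn_ord k; rewrite {2}m0.
have /choice[mu hmu] := fun k => dual_positive_coordinate k dual.
exists (m%:R^-1 *: \sum_k mu k); split.
  move=> l; rewrite mxE mulr_gt0 ?invr_gt0 ?ltr0n// summxE.
  rewrite (bigD1 l)//= ltr_pwDl//; first by case: (hmu l).
  by apply: sumr_ge0 => k _; case: (hmu k).
rewrite -scalemxAr mulmx_sumr (eq_bigr (fun=> lam)); last by move=> k _; case: (hmu k).
by rewrite sumr_const card_ord -[lam *+ m]scaler_nat scalerA mulVf ?scale1r// pnatr_eq0 -lt0n.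
Qed.

(** A right inverse [C] of the matrix lifts a small change [v - lam] to the change [C *m (v - lam)]
    of [mu], too small to make a coordinate negative. *)
Lemma positive_solution_interior : surjective_mx rA ->
  (exists mu : 'cV[R]_m, (forall k, 0 < mu k 0) /\ rA *m mu = lam) ->
  interior (cone rA) lam.
Proof.
move=> /surjective_mxP[C AC] [mu [mu0 Amu]].
have [d d0 dmu] := pos_lower_bound (f := fun k => mu k 0) mu0.
pose s := 1 + \sum_k \sum_i `|C k i|.
have ss k : \sum_i `|C k i| <= s.
  rewrite /s (bigD1 k)//= addrCA lerDl addr_ge0// sumr_ge0// => j _.
  by apply: sumr_ge0 => i _.
have s0 : 0 < s by rewrite ltr_pwDl// sumr_ge0// => k _; rewrite sumr_ge0.
apply/nbhs_ballP; exists (d / s); first by rewrite /= divr_gt0.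
move=> v [_ bv]; exists (mu + C *m (v - lam)); last first.
  by rewrite mulmxDr Amu mulmxA AC mul1mx addrC subrK.
have vl i : `|v i 0 - lam i 0| <= d / s.
  by rewrite distrC ltW//; have := bv i 0; rewrite -ball_normE.
move=> k; rewrite !mxE -lerBlDl sub0r lerNl.
apply: le_trans (ler_norm _) _; rewrite normrN (le_trans _ (dmu k))//.
apply: le_trans (ler_norm_sum _ _ _) _.
apply: (@le_trans _ _ (\sum_i `|C k i| * (d / s))).
  by apply: ler_sum => i _; rewrite normrM !mxE ler_wpM2l.
by rewrite -mulr_suml mulrCA ger_pMr// ler_pdivrMr// mul1r.
Qed.

(** Stepping from [lam] against the sum of all columns stays in the cone; undoing the step gives a
    solution with full support. Stepping in any direction [d] then writes [d] as a combination of
    columns. *)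
Lemma interior_support : interior (cone rA) lam ->
  exists mu : 'cV[R]_m, [/\ forall k, 0 <= mu k 0, rA *m mu = lam
           & surjective_mx (supp_cols rA mu)].
Proof.
move=> /nbhs_ballP[e /= e0 he].
have near (v : 'cV[R]_n) : exists2 t, 0 < t & cone rA (lam + t *: v).
  pose s := 1 + \sum_i `|v i 0|.
  have s0 : 0 < s by rewrite ltr_pwDl// sumr_ge0.
  exists (e / s); first by rewrite divr_gt0.
  apply: he; split=> [//|i j].
  rewrite ord1 -ball_normE /= !mxE opprD addNKr normrN.
  rewrite normrM (gtr0_norm (divr_gt0 e0 s0)) mulrAC ltr_pdivrMr// ltr_pM2l//.
  rewrite /s (bigD1 i)//= addrCA ltrDl ltr_wpDr// sumr_ge0//.
have [t t0 [w w0 wE]] := near (- (rA *m const_mx 1)).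
pose mu := w + t *: const_mx 1.
have mu0 k : 0 < mu k 0 by rewrite !mxE mulr1 ltr_wpDl// w0.
have Amu : rA *m mu = lam.
  by rewrite mulmxDr wE -scalemxAr scalerN subrK.
exists mu; split=> //; first by move=> k; rewrite ltW.
apply/seteqP; split=> // d _.
have [u u0 [x x0 xE]] := near d.
exists (\col_j (u^-1 *: (x - mu)) (enum_val j) 0) => //.
rewrite supp_colsE; last first.
  by move=> k; rewrite inE negbK => /eqP muk; have := mu0 k; rewrite muk ltxx.
by rewrite -scalemxAr mulmxBr xE Amu addrAC subrr add0r scalerA mulVf ?scale1r// gt_eqF.
Qed.

End Conditions.

(** * Necessity of the dual condition *)

Lemma natmx_addIr p q (B C D : 'M[nat]_(p, q)) : B + D = C + D -> B = C.
Proof.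
by move=> /matrixP h; apply/matrixP => i j; have := h i j; rewrite !mxE => /addIn.
Qed.

Section RealMx.
Variable R : realType.

Lemma real_mxD n m (M N : 'M[nat]_(n, m)) :
  real_mx R (M + N) = real_mx R M + real_mx R N.
Proof. by apply/matrixP => i j; rewrite !mxE natrD. Qed.

Lemma real_mxM n m q (M : 'M[nat]_(n, m)) (N : 'M[nat]_(m, q)) :
  real_mx R (M *m N) = real_mx R M *m real_mx R N.
Proof.
apply/matrixP => i j; rewrite !mxE natr_sum.
by apply: eq_bigr => k _; rewrite !mxE natrM.
Qed.

Lemma dotp_delta n (y : 'cV[R]_n) (j : 'I_n) :
  dotp y (real_mx R (delta_mx j 0)) = y j 0.
Proof.
rewrite /dotp (bigD1 j)//= !mxE !eqxx mulr1 big1 ?addr0// => i ij.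
by rewrite !mxE (negbTE ij) mulr0.
Qed.

End RealMx.

Section Kernel.
Variables (R : realType) (n m : nat) (n_gt0 : (0 < n)%N).
Variables (A : 'M[nat]_(n, m)) (lam : 'cV[R]_n) (lam_gt0 : forall i, 0 < lam i 0).
Variable p : matching_policy R A.
Local Notation law := (arrival_law lam).
Local Notation P := (@transition R n m A lam p).

Lemma sum_lam_gt0 : 0 < \sum_i lam i 0.
Proof.
rewrite (bigD1 (Ordinal n_gt0))//= ltr_pwDl// sumr_ge0// => i _.
exact: ltW.
Qed.

Lemma arrival_law_gt0 j : 0 < law j.
Proof. by rewrite divr_gt0// sum_lam_gt0. Qed.

Lemma sum_arrival_law : \sum_j law j = 1.
Proof. by rewrite -mulr_suml mulfV// gt_eqF// sum_lam_gt0. Qed.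

Definition arrival_kernel (j : 'I_n) (u v : chain_state p) : \bar R :=
  \esum_(s in [set s : 'cV[nat]_m | v.1 + A *m s = u.1 + delta_mx j 0])
    (rule u.1 u.2 j (s, v.2))%:E.

Lemma arrival_kernel_ge0 j u v : (0 <= arrival_kernel j u v)%E.
Proof. by apply: esum_ge0 => s _; rewrite lee_fin rule_ge0. Qed.

(** An outcome of positive probability is feasible, hence leads to exactly one queue vector: the
    double sum is a reindexing of the total mass of [rule]. *)
Lemma arrival_kernel_sum1 j u : \esum_(v in setT) arrival_kernel j u v = 1%E.
Proof.
rewrite esum_esum; last by move=> v s _ _; rewrite lee_fin rule_ge0.
pose D := [set d : 'cV[nat]_m * istate p | exists x, x + A *m d.1 = u.1 + delta_mx j 0].
rewrite -(rule_sum1 u.1 u.2 j) (esumID D); last by move=> *; rewrite lee_fin rule_ge0.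
rewrite [X in (_ + X)%E]esum1 ?adde0 ?setTI; last first.
  move=> [s i'] nD; congr (_%:E); apply/eqP; rewrite eq_le rule_ge0 andbT.
  rewrite leNgt; apply/negP => /rule_feasible feas; apply: nD.
  exists (\col_c ((u.1 + delta_mx j 0)%R c ord0 - (A *m s)%R c ord0)%N).
  apply/matrixP => c c'; rewrite (ord1 c') [LHS]mxE [X in (X + _)%R]mxE.
  exact: (subnK (feas c)).
rewrite -(reindex_esum (setT `*`` (fun v : chain_state p =>
    [set s : 'cV[nat]_m | v.1 + A *m s = u.1 + delta_mx j 0])) D
  (fun k => (k.2, k.1.2)) (fun d => (rule u.1 u.2 j d)%:E))//.
split=> [[[x i] s] [_ /= h]|[[x i] s] [[x' i'] s']|[s i] [x h]] /=.
- by exists x.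
- rewrite !inE /= => -[_ h] [_ h'] [ss ii]; rewrite ii ss; congr (_, _, _).
  by apply: (@natmx_addIr _ _ _ _ (A *m s)); rewrite h ss h'.
- by exists ((x, i), s).
Qed.

Lemma transitionE u v : P u v = (\sum_j (law j)%:E * arrival_kernel j u v)%E.
Proof. by []. Qed.

Lemma transition_ge0 u v : (0 <= P u v)%E.
Proof.
apply: sume_ge0 => j _; apply: mule_ge0; last exact: arrival_kernel_ge0.
by rewrite lee_fin ltW// arrival_law_gt0.
Qed.

Lemma transition_sum1 u : \esum_(v in setT) P u v = 1%E.
Proof.
rewrite esum_sum; last first.
  move=> v j _ _; apply: mule_ge0; last exact: arrival_kernel_ge0.
  by rewrite lee_fin ltW// arrival_law_gt0.
rewrite (eq_bigr (fun j => (law j)%:E)) ?sumEFin ?sum_arrival_law// => j _.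
rewrite esumZl ?(ltW (arrival_law_gt0 _))//; last by move=> v; exact: arrival_kernel_ge0.
by rewrite arrival_kernel_sum1 mule1.
Qed.

(** For an arbitrary policy only the law of the arriving class is known, so the bound [c j] must
    hold for every activation vector compatible with an arrival of class [j]. *)
Lemma transition_lower u (c : 'I_n -> R) (f : chain_state p -> \bar R) :
  (forall v, 0 <= f v)%E -> (forall j, 0 <= c j) ->
  (forall j v s, v.1 + A *m s = u.1 + delta_mx j 0 -> ((c j)%:E <= f v)%E) ->
  ((\sum_j law j * c j)%:E <= \esum_(v in setT) (P u v * f v))%E.
Proof.
move=> f0 c0 cf.
have law0 j : 0 <= law j by rewrite ltW// arrival_law_gt0.
apply: (@le_trans _ _ (\esum_(v in setT)
    \sum_j (law j * c j)%:E * arrival_kernel j u v)%E).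
  rewrite esum_sum; last first.
    move=> v j _ _; apply: mule_ge0; last exact: arrival_kernel_ge0.
    by rewrite lee_fin mulr_ge0.
  rewrite -sumEFin; apply: lee_sum => j _; rewrite esumZl ?(mulr_ge0 (law0 j))//.
    by rewrite arrival_kernel_sum1 mule1.
  by move=> v; exact: arrival_kernel_ge0.
apply: le_esum => v _; rewrite ge0_sume_distrl; last first.
  move=> j _; apply: mule_ge0; last exact: arrival_kernel_ge0.
  by rewrite lee_fin.
apply: lee_sum => j _; rewrite EFinM -!muleA lee_wpmul2l ?lee_fin//.
rewrite muleC; have [[s sv]|ns] := pselect (exists s, v.1 + A *m s = u.1 + delta_mx j 0).
  by rewrite lee_wpmul2l ?arrival_kernel_ge0// (cf _ _ _ sv).
rewrite /arrival_kernel (_ : [set s | _] = set0) ?esum_set0 ?mul0e//.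
by apply/seteqP; split=> // s hs; apply: ns; exists s.
Qed.

Lemma transition_gt0 u v : (0 < P u v)%E ->
  exists j s, v.1 + A *m s = u.1 + delta_mx j 0.
Proof.
move=> Puv; apply: contrapT => /forallNP h; move: Puv; rewrite transitionE.
rewrite big1 ?ltxx// => j _; rewrite /arrival_kernel (_ : [set s | _] = set0).
  by rewrite esum_set0 mule0.
by apply/seteqP; split=> // s hs; case: (h j); exists s.
Qed.

Lemma stable_dual : stable lam p -> dual_condition A lam.
Proof.
move=> st y y0 yA; rewrite ltNge; apply/negP => ylam.
have /st pr : communicates P (empty_state p) (empty_state p).
  by split; exists 0%N; rewrite /= eqxx lte_fin ltr01.
pose w (u : chain_state p) := - dotp y (real_mx R u.1).
(* Activations can only lower [<y, X>], so after an arrival of class [j] the new value of [w] is at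
   least [w u - y j]. *)
pose c (u : chain_state p) j := Num.max 0 (w u - y j 0).
pose f (u : chain_state p) := (Num.max 0 (w u))%:E.
have c0 u j : 0 <= c u j by rewrite le_max lexx.
have f0 u : (0 <= f u)%E by rewrite lee_fin le_max lexx.
have cf u j v s : v.1 + A *m s = u.1 + delta_mx j 0 -> ((c u j)%:E <= f v)%E.
  move=> /(congr1 (fun x => dotp y (real_mx R x))).
  rewrite !real_mxD !dotpDr real_mxM dotp_mulmx dotp_delta => E.
  have : 0 <= \sum_k real_mx R s k 0 * dotp y (col k (real_mx R A)).
    by apply: sumr_ge0 => k _; rewrite mulr_ge0// mxE ler0n.
  rewrite lee_fin /c /w => h; rewrite ge_max le_max lexx /= le_max.
  by apply/orP; right; lra.
have law0 j : 0 <= law j by rewrite ltW// arrival_law_gt0.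
(* An arrival of such a class at the empty state gives the strict initial gain. Without one,
   [<y, lam> <= 0] and [lam > 0] would force [y = 0]. *)
have [j yj] : exists j, y j 0 < 0.
  apply: contrapT => /forallNP h.
  have {}h j : 0 <= y j 0 by rewrite leNgt; apply/negP/h.
  have : \sum_i y i 0 * lam i 0 == 0.
    by rewrite eq_le ylam sumr_ge0// => i _; rewrite mulr_ge0// ltW.
  rewrite psumr_eq0 => [/allP h0|i _]; last by rewrite mulr_ge0// ltW.
  move/eqP: y0; apply; apply/matrixP => i k; rewrite ord1 mxE.
  have := h0 i (mem_index_enum i); rewrite mulf_eq0 => /orP[/eqP//|].
  by rewrite gt_eqF.
pose L := \sum_i `|y i 0| + 1.
suff : ~ positive_recurrent P (empty_state p) by apply.
apply: (@submartingale_not_positive_recurrent R _ P transition_ge0 transition_sum1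
  (empty_state p) f (fun u => \sum_i u.1 i ord0)%N L (law j * - y j 0)) => //.
- by rewrite ltr_wpDl// sumr_ge0.
- by rewrite mulr_gt0 ?arrival_law_gt0 ?oppr_gt0.
- rewrite /f /w (_ : real_mx R _ = 0) ?/dotp.
    rewrite big1 ?oppr0 ?maxxx// => i _; by rewrite mxE mulr0.
  by apply/matrixP => i k; rewrite !mxE.
- by rewrite big1// => i _; rewrite mxE.
- move=> u v /transition_gt0[i [s /matrixP E]].
  have -> : (\sum_k u.1 k ord0).+1 = (\sum_k (u.1 + delta_mx i 0)%R k ord0)%N.
    under [in RHS]eq_bigr do rewrite mxE.
    rewrite big_split /= -addn1; congr (_ + _)%N.
    by rewrite (bigD1 i)//= mxE !eqxx big1// => k ki; rewrite mxE (negbTE ki).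
  by apply: leq_sum => k _; rewrite -E mxE leq_addr.
- move=> u; rewrite lee_fin ge_max mulr_ge0 ?ler0n ?addr_ge0 ?sumr_ge0//=.
  rewrite /w (le_trans (ler_norm _))// normrN (le_trans (ler_norm_sum _ _ _))//.
  rewrite mulrDl mul1r ler_wpDr// mulr_suml; apply: ler_sum => i _.
  rewrite normrM ler_wpM2l// mxE normr_nat ler_nat.
  by rewrite (bigD1 i)//= leq_addr.
- move=> u; apply: le_trans (transition_lower f0 (c0 u) (cf u)).
  rewrite lee_fin ge_max; apply/andP; split.
    by apply: sumr_ge0 => i _; rewrite mulr_ge0.
  apply: (@le_trans _ _ (\sum_i law i * (w u - y i 0))); last first.
    by apply: ler_sum => i _; rewrite ler_wpM2l// le_max lexx orbT.
  under eq_bigr do rewrite mulrBr.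
  rewrite sumrB -mulr_suml sum_arrival_law mul1r lerDl oppr_ge0.
  rewrite (eq_bigr (fun i => y i 0 * lam i 0 / \sum_i lam i 0)); last first.
    by move=> i _; rewrite mulrC mulrA.
  by rewrite -mulr_suml pmulr_lle0// invr_gt0 sum_lam_gt0.
- apply: le_trans (transition_lower f0 (c0 _) (cf _)).
  rewrite lee_fin (bigD1 j)//= ler_wpDr//.
    by apply: sumr_ge0 => i _; rewrite mulr_ge0.
  rewrite ler_wpM2l// le_max; apply/orP; right.
  rewrite /w (_ : real_mx R _ = 0); last by apply/matrixP => i k; rewrite !mxE.
  by rewrite /dotp big1 ?oppr0 ?add0r// => i _; rewrite mxE mulr0.
Qed.

End Kernel.

(** * Policies with pending activations *)

Section Policy.
Variables (R : realType) (n m : nat) (A : 'M[nat]_(n, m)).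
Implicit Types (X : 'cV[nat]_n) (D s : 'cV[nat]_m) (j : 'I_n).

Definition blocked X D : Prop :=
  forall k, (0 < D k ord0)%N -> exists i, (X i ord0 < A i k)%N.

Lemma natmx_mulE D i : (A *m D)%R i ord0 = (\sum_k A i k * D k ord0)%N.
Proof. by rewrite mxE. Qed.

(** Every pending edge newly enabled by an arrival of class [j] needs all
    [X j + 1] items of class [j], so at most one of them can be activated. *)
Lemma exec_le X D s j X' D' E :
  blocked X D -> D' + E = D + s -> X' + A *m E = X + delta_mx j 0 ->
  (\sum_k E k ord0 <= (\sum_k s k ord0).+1)%N.
Proof.
move=> bl /matrixP DE /matrixP XE.
have {}DE k : (D' k ord0 + E k ord0 = D k ord0 + s k ord0)%N.
  by have := DE k ord0; rewrite !mxE.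
have {}XE i : (X' i ord0 + \sum_k A i k * E k ord0 = X i ord0 + (i == j))%N.
  by have := XE i ord0; rewrite !mxE eqxx andbT; case: (i == j).
have AE i k : (A i k * E k ord0 <= X i ord0 + (i == j))%N.
  by rewrite -XE (bigD1 k)//= addnCA leq_addr.
(* Executing more copies than were just scheduled uses an old pending one, so [k] was blocked before
   the arrival; only a shortage of class [j] can have been lifted. *)
have AX k : (s k ord0 < E k ord0)%N -> (X j ord0 < A j k)%N.
  move=> sE; have [|i iX] := bl k; first by have := DE k; lia.
  have := AE i k; case: (i =P j) => [<-//|_] /=; rewrite addn0 => le.
  move: iX; rewrite ltnNge => /negP[].
  exact: leq_trans (leq_pmulr _ (leq_ltn_trans (leq0n _) sE)) le.
pose F k := if (s k ord0 < E k ord0)%N then E k ord0 else 0%N.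
have F1 : (\sum_k F k <= 1)%N.
  have : ((X j ord0).+1 * \sum_k F k <= (X j ord0).+1 * 1)%N.
    rewrite (@leq_trans (\sum_k A j k * E k ord0))//; last first.
      have := leq_addl (X' j ord0) (\sum_k A j k * E k ord0).
      by rewrite XE eqxx addn1 muln1.
    rewrite big_distrr /=; apply: leq_sum => k _; rewrite /F.
    by case: ifP => [/AX h|_]; [rewrite leq_mul2r h orbT|rewrite muln0].
  by rewrite leq_pmul2l.
rewrite -[leqRHS]addn1 (leq_trans _ (leq_add (leqnn _) F1))// -big_split /=.
by apply: leq_sum => k _; rewrite /F; case: ltnP; rewrite ?addn0 ?leq_addl.
Qed.

(** An execution of maximal size leaves nothing feasible pending. The cap [b.+1] keeps activations
    bounded from every state; by [exec_le] it is never what stops the execution from a blocked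
    state. *)
Lemma exec_exists (b : nat) X D j s :
  exists t : 'cV[nat]_m * 'cV[nat]_m * 'cV[nat]_n,
  [/\ t.1.2 + t.1.1 = D + s, t.2 + A *m t.1.1 = X + delta_mx j 0,
      (\sum_k t.1.1 k ord0 <= b.+1)%N &
      blocked X D -> (\sum_k s k ord0 <= b)%N -> blocked t.2 t.1.2].
Proof.
pose ok c := exists t : 'cV[nat]_m * 'cV[nat]_m * 'cV[nat]_n,
  [/\ t.1.2 + t.1.1 = D + s, t.2 + A *m t.1.1 = X + delta_mx j 0 &
      (\sum_k t.1.1 k ord0 = c)%N].
pose q c := `[< ok c >] && (c <= b.+1)%N.
have q0 : exists c, q c.
  exists 0%N; apply/andP; split=> //; apply/asboolP.
  exists (0, D + s, X + delta_mx j 0); split=> /=; rewrite ?addr0 ?mulmx0 ?addr0//.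
  by rewrite big1// => k _; rewrite mxE.
have qb c : q c -> (c <= b.+1)%N by case/andP.
case: (ex_maxnP q0 qb) => c /andP[/asboolP[[[E D'] X'] /= [DE XE Ec]] cb] cmax.
exists (E, D', X'); split=> //=; first by rewrite Ec.
move=> bl sb k Dk; apply: contrapT => /forallNP nb.
have {}nb i : (A i k <= X' i ord0)%N by rewrite leqNgt; apply/negP/nb.
have okS : ok c.+1.
  exists (E + delta_mx k 0, \col_l (D' l ord0 - (l == k))%N,
          \col_i (X' i ord0 - A i k)%N); split => /=.
  - rewrite -DE; apply/matrixP => l l'; rewrite (ord1 l' : l' = ord0) !mxE eqxx andbT.
    case: (l =P k) => [->|_]; rewrite -![(_ + _)%R]/(_ + _)%N /=; first by lia.
    by rewrite subn0 addn0.
  - rewrite -XE; apply/matrixP => i i'; rewrite (ord1 i' : i' = ord0) mulmxDr -colE !mxE.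
    by rewrite -![(_ + _)%R]/(_ + _)%N addnCA (subnK (nb i)) addnC.
  - under eq_bigr do rewrite mxE; rewrite big_split /= -[RHS]addn1 Ec; congr (_ + _)%N.
    by rewrite (bigD1 k)//= mxE !eqxx big1// => l /negbTE lk; rewrite mxE lk.
have [cb'|cb'] := leqP c.+1 b.+1.
  have : q c.+1 by rewrite /q cb' andbT; apply/asboolP.
  by move/cmax; rewrite ltnn.
case: okS => -[[E1 D1] X1] /= [DE1 XE1 Ec1].
have := exec_le bl DE1 XE1; rewrite Ec1 => /leq_trans/(_ (sb : _ < b.+1)%N).
by rewrite leqNgt cb'.
Qed.

Variables (ctrl : ('I_n -> int) -> 'cV[nat]_m) (b : nat).
Hypothesis ctrl_le : forall z, (\sum_k ctrl z k ord0 <= b)%N.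

(** The queues that would remain if all pending activations [D] were
    performed at once. *)
Definition balance X D (i : 'I_n) : int := (X i ord0)%:Z - ((A *m D)%R i ord0)%:Z.

Definition exec X D j : 'cV[nat]_m * 'cV[nat]_m * 'cV[nat]_n :=
  projT1 (cid (exec_exists b X D j (ctrl (balance X D)))).

Lemma execP X D j (t := exec X D j) :
  [/\ t.1.2 + t.1.1 = D + ctrl (balance X D), t.2 + A *m t.1.1 = X + delta_mx j 0,
      (\sum_k t.1.1 k ord0 <= b.+1)%N & blocked X D -> blocked t.2 t.1.2].
Proof.
rewrite /t /exec; case: cid => t' /= [h1 h2 h3 h4]; split=> // bl.
exact: (h4 bl (ctrl_le _)).
Qed.

Definition det_rule X D j (d : 'cV[nat]_m * 'cV[nat]_m) : R :=
  (d == (exec X D j).1)%:R.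

Lemma det_rule_sum1 X D j : \esum_(d in setT) (det_rule X D j d)%:E = 1%E.
Proof.
rewrite (esum_split1 (exec X D j).1); last by move=> z; rewrite lee_fin ler0n.
rewrite /det_rule eqxx esum1 ?adde0// => d /= /eqP/negbTE ->; by [].
Qed.

Lemma det_rule_gt0 X D j d : 0 < det_rule X D j d -> d = (exec X D j).1.
Proof. by rewrite /det_rule; case: eqP => //; rewrite ltxx. Qed.

Definition pending_policy : matching_policy R A.
Proof.
refine (@MatchingPolicy R n m A ('cV[nat]_m : countType) 0 det_rule _ det_rule_sum1 _ _).
- by move=> x i j d; rewrite ler0n.
- move=> X D j s D' /det_rule_gt0 E c; have [_ XE _ _] := execP X D j.
  by rewrite -XE -E /= [X in (_ <= X)%N]mxE leq_addl.
- exists b.+1 => X D j s D' /det_rule_gt0 E.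
  by have [_ _ + _] := execP X D j; rewrite -E.
Defined.

Definition next (u : chain_state pending_policy) (j : 'I_n) : chain_state pending_policy :=
  ((exec u.1 u.2 j).2, (exec u.1 u.2 j).1.2).

Lemma pending_kernelE j u v :
  @arrival_kernel R n m A pending_policy j u v = ((v == next u j)%:R : R)%:E.
Proof.
rewrite /arrival_kernel /= esum_mkcond (esum_split1 (exec u.1 u.2 j).1.1); last first.
  by move=> s; case: ifP => // _; rewrite lee_fin ler0n.
rewrite [X in (_ + X)%E]esum1 ?adde0; last first.
  move=> s /= sE; case: ifP => // _; rewrite /det_rule.
  by case: eqP => // E; case: sE; rewrite -E.
have [_ XE _ _] := execP u.1 u.2 j; rewrite /det_rule /next.
case: v => X D; move: XE; case: (exec u.1 u.2 j) => -[E D'] X' /= XE.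
case: ifPn => [/set_mem/=|/negP nin]; rewrite xpair_eqE.
  by rewrite -XE => /natmx_addIr ->; rewrite !xpair_eqE !eqxx.
by case: (X =P X') => // XX; case: nin; apply/mem_set; rewrite /= XX.
Qed.

(** Executions lower [X] and [A D] equally and cancel; only the arrival and the newly scheduled
    activations remain. *)
Lemma balance_next u j i : balance (next u j).1 (next u j).2 i =
  balance u.1 u.2 i + (i == j)%:Z - ((A *m ctrl (balance u.1 u.2))%R i ord0)%:Z.
Proof.
rewrite {1}/balance /next /=; have [DE XE _ _] := execP u.1 u.2 j.
have /matrixP/(_ i ord0) := XE; have := congr1 (fun d => (A *m d) i ord0) DE.
rewrite !mulmxDr; rewrite /balance; set s := ctrl _.
rewrite [LHS]mxE [RHS]mxE => h1; rewrite [LHS]mxE [RHS]mxE [delta_mx _ _ _ _]mxE eqxx andbT.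
have H (d' e d s' x' x t : nat) : (d' + e = d + s')%N -> (x' + e = x + t)%N ->
  x'%:Z - d'%:Z = x%:Z - d%:Z + t%:Z - s'%:Z by lia.
by case: (i == j) => h2; exact: H h1 h2.
Qed.

Lemma blocked_next u j : blocked u.1 u.2 -> blocked (next u j).1 (next u j).2.
Proof. by move=> h; have [_ _ _] := execP u.1 u.2 j; apply. Qed.

(** If [X = A D] and [D k > 0], then edge [k] is feasible in [X]. *)
Lemma blocked_balance0 (u : chain_state pending_policy) :
  blocked u.1 u.2 -> (forall i, balance u.1 u.2 i = 0) -> u = empty_state pending_policy.
Proof.
case: u => X D /= bl z0.
have XD i : X i ord0 = (A *m D)%R i ord0.
  by apply/eqP; rewrite -eqz_nat -subr_eq0; apply/eqP/z0.
have D0 : D = 0.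
  apply/matrixP => k l; rewrite (ord1 l : l = ord0) mxE; apply/eqP; rewrite -leqn0 leqNgt.
  apply/negP => Dk; have [i] := bl k Dk; rewrite XD natmx_mulE (bigD1 k)//=.
  by rewrite ltnNge (leq_trans (leq_pmulr _ Dk))// leq_addr.
congr (_, _) => //; apply/matrixP => i l; rewrite (ord1 l : l = ord0).
by rewrite XD D0 mulmx0 !mxE.
Qed.

End Policy.

(** * Drift of the threshold rule and stability *)

Section Drift.
Variable R : realType.

(** Expanding the square, the linear term averages to the mean drift, and each increment has size at
    most [1 + B]. *)
Lemma sq_step n (q z b : 'I_n -> R) (B : R) : (forall j, 0 <= q j) -> \sum_j q j = 1 ->
  (forall i, 0 <= b i <= B) ->
  \sum_j q j * \sum_i (z i + (i == j)%:R - b i) ^+ 2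
   <= \sum_i z i ^+ 2 + 2 * \sum_i z i * (q i - b i) + n%:R * (1 + B) ^+ 2.
Proof.
move=> q0 q1 bB.
have le j : \sum_i (z i + (i == j)%:R - b i) ^+ 2 <=
    \sum_i (z i ^+ 2 + 2 * (z i * ((i == j)%:R - b i)) + (1 + B) ^+ 2).
  apply: ler_sum => i _; have := bB i => /andP[b0 b1].
  by case: (i == j) => /=; nra.
apply: (@le_trans _ _ (\sum_j q j *
    \sum_i (z i ^+ 2 + 2 * (z i * ((i == j)%:R - b i)) + (1 + B) ^+ 2))).
  by apply: ler_sum => j _; rewrite ler_wpM2l.
rewrite le_eqVlt; apply/orP; left; apply/eqP.
under eq_bigr => j _ do rewrite !big_split /= -mulr_sumr sumr_const card_ord !mulrDr.
rewrite !big_split /= -!mulr_suml q1 !mul1r.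
congr (_ + _ + _); last by rewrite mulr_natl.
under eq_bigr => j _ do rewrite mulrCA.
rewrite -mulr_sumr; congr (2 * _).
under [LHS]eq_bigr => j _ do rewrite mulr_sumr.
rewrite exchange_big /=; apply: eq_bigr => i _.
transitivity (z i * \sum_j (q j * (i == j)%:R - q j * b i)).
  by rewrite mulr_sumr; apply: eq_bigr => j _; ring.
rewrite sumrB -mulr_suml q1 mul1r; congr (_ * (_ - _)).
rewrite (bigD1 i)//= eqxx mulr1 big1 ?addr0// => j /negbTE ji.
by rewrite eq_sym ji mulr0.
Qed.

Lemma surjective_row n m (A : 'M[nat]_(n, m)) (mu : 'cV[R]_m) (i : 'I_n) :
  surjective_mx (supp_cols (real_mx R A) mu) -> exists k, (0 < A i k)%N.
Proof.
move=> /surjective_mxP[C /matrixP/(_ i i)]; rewrite !mxE eqxx => E.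
apply: contrapT => /forallNP h; move/eqP: E; rewrite big1 => [|j _].
  by rewrite eq_sym oner_eq0.
rewrite !mxE; have := h (enum_val j); move/negP; rewrite -leqNgt leqn0 => /eqP ->.
by rewrite mul0r.
Qed.

(** Scheduling [C] copies of every edge with positive weight [<z, A_k>] pushes
    [z] towards the origin at linear rate, since [lam] is a combination of the
    columns whose support spans. *)
Lemma threshold_drift n m (A : 'M[nat]_(n, m)) (q : 'I_n -> R) (nu : 'cV[R]_m) :
  (forall k, 0 <= nu k 0) -> (forall i, q i = \sum_k (A i k)%:R * nu k 0) ->
  surjective_mx (supp_cols (real_mx R A) nu) ->
  exists C : nat, exists2 eta : R, 0 < eta & forall z : 'I_n -> R,
    \sum_i z i * (q i - \sum_k (A i k)%:R *
       (if 0 < \sum_i z i * (A i k)%:R then C%:R else 0)) <= - eta * \sum_i `|z i|.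
Proof.
move=> nu0 qE /surjective_mxP[B AB].
(* With [C] at least [nu k + 1], the term [g k * (nu k - C)] is at most [- g k] whenever
   [g k > 0]. *)
pose C := (Num.truncn (\sum_k nu k 0 + 1)).+1; exists C.
have Cnu k : nu k 0 + 1 <= C%:R.
  apply: ltW; apply: le_lt_trans (truncnS_gt _).
  by rewrite lerD2r (bigD1 k)//= lerDl sumr_ge0.
have [d0 d0_gt0 hd0] : exists2 d, 0 < d & forall k, nu k 0 != 0 -> d <= nu k 0.
  have [|d d_gt0 hd] := @pos_lower_bound R m (fun k => if nu k 0 == 0 then 1 else nu k 0).
    by move=> k; case: ifPn => // nuk; rewrite lt_def nuk nu0.
  by exists d => // k /negbTE nuk; have := hd k; rewrite nuk.
pose d := Num.min d0 1.
have d_gt0 : 0 < d by rewrite lt_min d0_gt0 ltr01.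
pose s := 1 + \sum_j \sum_i `|B j i|.
have s_gt0 : 0 < s by rewrite ltr_pwDl// sumr_ge0// => j _; rewrite sumr_ge0.
exists (d / s); first by rewrite divr_gt0.
move=> z; pose g k := \sum_i z i * (A i k)%:R.
(* The supporting columns span, so the right inverse [B] recovers [z] from the weights [g k] on the
   support. *)
have zle : \sum_i `|z i| <= s * \sum_(k in supp nu) `|g k|.
  have zE i : z i = \sum_j g (enum_val j) * B j i.
    rewrite [LHS](_ : _ = \sum_l z l * (1%:M : 'M[R]_n) l i); last first.
      rewrite (bigD1 i)//= mxE eqxx mulr1 big1 ?addr0// => l /negbTE li.
      by rewrite mxE li mulr0.
    rewrite -AB; under eq_bigr do rewrite mxE mulr_sumr.
    rewrite exchange_big; apply: eq_bigr => j _ /=; rewrite /g mulr_suml.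
    by apply: eq_bigr => l _; rewrite !mxE mulrA.
  apply: (@le_trans _ _ (\sum_i \sum_j `|g (enum_val j)| * `|B j i|)).
    apply: ler_sum => i _; rewrite zE (le_trans (ler_norm_sum _ _ _))//.
    by apply: ler_sum => j _; rewrite normrM.
  rewrite exchange_big [X in s * X]big_enum_val mulr_sumr; apply: ler_sum => j _ /=.
  rewrite -mulr_sumr mulrC ler_wpM2r// /s (bigD1 j)//= addrCA lerDl.
  by rewrite addr_ge0// sumr_ge0// => l _; rewrite sumr_ge0.
apply: (@le_trans _ _ (- d * \sum_(k in supp nu) `|g k|)); last first.
  by rewrite !mulNr lerN2 -mulrA ler_pM2l// mulrC ler_pdivrMr// mulrC.
have -> : \sum_i z i * (q i - \sum_k (A i k)%:R * (if 0 < g k then C%:R else 0)) =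
    \sum_k g k * (nu k 0 - if 0 < g k then C%:R else 0).
  under eq_bigr do rewrite qE -sumrB mulr_sumr.
  rewrite exchange_big; apply: eq_bigr => k _ /=; rewrite /g mulr_suml.
  by apply: eq_bigr => i _; ring.
rewrite mulr_sumr [leRHS]big_mkcond; apply: ler_sum => k _.
have := nu0 k; have := Cnu k; have d1 : d <= 1 by rewrite ge_min lexx orbT.
rewrite inE; case: ltP => gk; case: ifPn => nuk.
- by rewrite gtr0_norm//; nra.
- by nra.
- rewrite ler0_norm// => _ _.
  have : d <= nu k 0 by rewrite ge_min hd0.
  by nra.
- by move=> _; nra.
Qed.

End Drift.

(** * Return to the empty state under the push rule *)

Section Stability.
Variables (R : realType) (n m : nat) (n_gt0 : (0 < n)%N).
Variables (A : 'M[nat]_(n, m)) (lam : 'cV[R]_n) (lam_gt0 : forall i, 0 < lam i 0).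
Hypothesis A_row : forall i, exists k, (0 < A i k)%N.
Local Notation law := (arrival_law lam).

Definition l1 (z : 'I_n -> int) : nat := (\sum_i `|z i|)%N.

Variables (C r : nat).

(** Far from the origin the threshold rule is used.  Near the origin, [r + 1]
    activations of every edge make the balance nonpositive; no activation is
    then scheduled while it is nonpositive and nonzero, so that arrivals alone
    can bring it exactly to [0]. *)
Definition push (z : 'I_n -> int) : 'cV[nat]_m :=
  if (l1 z <= r)%N && ~~ ([forall i, z i <= 0] && (0 < l1 z)%N) then const_mx r.+1
  else \col_k (if 0 < \sum_i z i * (A i k)%:Z then C else 0%N).

Definition push_bound : nat := (m * (C + r.+1))%N.
Definition total_incidence : nat := (\sum_i \sum_k A i k)%N.
(** Size [r] of an entry, plus one arrival, plus the largest possible decrease by [A *m push z]. *)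
Definition step_bound : nat := (r.+1 + total_incidence * (C + r.+1))%N.

Lemma push_le_entry z k : (push z k ord0 <= C + r.+1)%N.
Proof.
rewrite /push; case: ifP => _; rewrite mxE ?leq_addl//.
by case: ifP => // _; rewrite leq_addr.
Qed.

Lemma push_le z : (\sum_k push z k ord0 <= push_bound)%N.
Proof.
rewrite /push_bound -[X in (_ <= X * _)%N]card_ord -sum_nat_const.
by apply: leq_sum => k _; exact: push_le_entry.
Qed.

Local Notation pol := (@pending_policy R n m A push push_bound push_le).
Local Notation P := (@transition R n m A lam pol).
Local Notation next := (@next R n m A push push_bound push_le).
Local Notation bal u := (balance A u.1 u.2).

Lemma esum_pending_transition (u : chain_state pol) (f : chain_state pol -> \bar R) :
  (forall v, 0 <= f v)%E ->
  \esum_(v in setT) (P u v * f v)%E = (\sum_j (law j)%:E * f (next u j))%E.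
Proof.
move=> f0; have law0 j : 0 <= law j by rewrite ltW// arrival_law_gt0.
rewrite -(eq_esum (a := fun v => (\sum_j (law j)%:E * ((v == next u j)%:R : R)%:E * f v)%E)).
  rewrite esum_sum; last by move=> v j _ _; rewrite !mule_ge0// lee_fin.
  apply: eq_bigr => j _; rewrite (esum_split1 (next u j)); last first.
    by move=> v; rewrite !mule_ge0// lee_fin.
  rewrite eqxx mule1 esum1 ?adde0// => v /eqP/negbTE ->.
  by rewrite mule0 mul0e.
move=> v _; rewrite transitionE ge0_sume_distrl.
  by apply: eq_bigr => j _; rewrite pending_kernelE.
by move=> j _; apply: mule_ge0; [rewrite lee_fin|exact: arrival_kernel_ge0].
Qed.

Lemma bal_next u j i : bal (next u j) i =
  bal u i + (i == j)%:Z - ((A *m push (bal u))%R i ord0)%:Z.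
Proof. exact: balance_next. Qed.

Lemma Apush_le z i : ((A *m push z)%R i ord0 <= total_incidence * (C + r.+1))%N.
Proof.
rewrite natmx_mulE (@leq_trans (\sum_k A i k * (C + r.+1)))//.
  by apply: leq_sum => k _; rewrite leq_mul2l push_le_entry orbT.
by rewrite -big_distrl /= leq_mul2r /total_incidence [X in (_ <= X)%N](bigD1 i)//= leq_addr orbT.
Qed.

Lemma l1_entry z i : (`|z i| <= l1 z)%N.
Proof. by rewrite /l1 (bigD1 i)//= leq_addr. Qed.

Lemma bal_next_le u j i : (l1 (bal u) <= r)%N -> (`|bal (next u j) i| <= step_bound)%N.
Proof.
move=> h; rewrite bal_next /step_bound; have := Apush_le (bal u) i.
have := leq_trans (l1_entry (bal u) i) h.
move: (bal u i) (nat_of_bool _) (leq_b1 (i == j)) ((A *m _)%R i ord0) (total_incidence * _)%N.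
by move=> x t ? y w; lia.
Qed.

Lemma l1_bal_next_le u j : (l1 (bal u) <= r)%N ->
  (l1 (bal (next u j)) <= n * step_bound)%N.
Proof.
move=> h; rewrite -[X in (_ <= X * _)%N]card_ord -sum_nat_const.
by apply: leq_sum => i _; exact: bal_next_le.
Qed.

Lemma l1_gt0 z : (0 < l1 z)%N = [exists i, z i != 0].
Proof.
rewrite lt0n; apply/idP/existsP => [|[i zi]].
  move=> lz; apply: contrapT => /forallNP h; move/eqP: lz; apply.
  by rewrite /l1 big1// => i _; have /negP := h i; rewrite negbK => /eqP ->.
by rewrite -lt0n (leq_trans _ (l1_entry z i))// absz_gt0.
Qed.

Lemma push_idle z : (forall i, z i <= 0) -> (0 < l1 z)%N -> push z = 0.
Proof.
move=> z0 lz; rewrite /push lz andbT (introT forallP z0) andbF.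
apply/matrixP => k l; rewrite !mxE ltNge sumr_le0// => i _.
by rewrite mulr_le0_ge0.
Qed.

(** Every class lies in some edge, so [r + 1] copies of all edges outweigh an entry of size at most
    [r] plus the arrival. *)
Lemma push_below u j : (l1 (bal u) <= r)%N ->
  ~~ ([forall i, bal u i <= 0] && (0 < l1 (bal u))%N) ->
  forall i, bal (next u j) i <= 0.
Proof.
move=> h1 h2 i; rewrite bal_next.
have : (r.+1 <= (A *m push (bal u))%R i ord0)%N.
  rewrite natmx_mulE /push h1 h2 /=; have [k Ak] := A_row i.
  by rewrite (bigD1 k)//= mxE (leq_trans (leq_pmull _ Ak))// leq_addr.
have := leq_trans (l1_entry (bal u) i) h1.
move: (bal u i) (nat_of_bool _) (leq_b1 (i == j)) ((A *m _)%R i ord0) => x t ? y.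
by lia.
Qed.

Local Notation e := (empty_state pol).

Lemma bal_neq_empty u : blocked A u.1 u.2 -> u <> e -> (0 < l1 (bal u))%N.
Proof.
move=> bl ue; rewrite l1_gt0; apply: contra_notT ue => /existsPn h.
by apply: blocked_balance0 => // i; have := h i; rewrite negbK => /eqP.
Qed.

(** Unlike [hit], this counts time [0], as the first-step recursion for [hit] requires. *)
Definition reach t (u : chain_state pol) : \bar R :=
  if u == e then 1%E else hit P e t u.

Lemma pol_ge0 u v : (0 <= P u v)%E. Proof. exact: transition_ge0. Qed.
Lemma pol_sum1 u : \esum_(v in setT) P u v = 1%E. Proof. exact: transition_sum1. Qed.

Lemma hit_reach t u : hit P e t.+1 u = (\sum_j (law j)%:E * reach t (next u j))%E.
Proof.
rewrite (hit_stepE pol_ge0); apply: esum_pending_transition => v.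
by rewrite /reach; case: ifP => _; rewrite ?lee01// (hit_ge0 pol_ge0).
Qed.

Lemma reach_ge0 t u : (0 <= reach t u)%E.
Proof. by rewrite /reach; case: ifP => _; rewrite ?lee01// (hit_ge0 pol_ge0). Qed.

Section Reach.
Variable d : R.
Hypothesis d_gt0 : 0 < d.
Hypothesis d_law : forall j, d <= law j.

Lemma d_le1 : d <= 1.
Proof.
rewrite -(sum_arrival_law n_gt0 lam_gt0) (bigD1 (Ordinal n_gt0))//=.
rewrite (le_trans (d_law (Ordinal n_gt0)))// lerDl sumr_ge0// => j _.
by rewrite ltW// arrival_law_gt0.
Qed.

(** While the balance is nonpositive and nonzero nothing is scheduled; an arrival at a negative
    entry, of chance at least [d], lowers [l1] by one. *)
Lemma reach_below t u : blocked A u.1 u.2 -> (forall i, bal u i <= 0) ->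
  (l1 (bal u) <= t)%N -> ((d ^+ t)%:E <= reach t u)%E.
Proof.
elim: t u => [|t IH] u bl u0 lt.
  case: (u =P e) => [ue|/(bal_neq_empty bl)]; last by rewrite ltnNge lt.
  by rewrite /reach ue eqxx.
case: (u =P e) => [ue|ue].
  by rewrite /reach ue eqxx lee_fin exprn_ile1// ?d_le1// ltW.
have lu := bal_neq_empty bl ue.
have /existsP[j uj] : [exists i, bal u i != 0] by rewrite -l1_gt0.
rewrite /reach (introF eqP ue) hit_reach (bigD1 j)//=.
have nx i : bal (next u j) i = bal u i + (i == j)%:Z.
  by rewrite bal_next (push_idle u0 lu) mulmx0 mxE subr0.
have uj0 : bal u j < 0 by rewrite lt_neqAle uj u0.
apply: (@le_trans _ _ ((law j)%:E * reach t (next u j))%E); last first.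
  rewrite leeDl// sume_ge0// => i _; rewrite mule_ge0 ?reach_ge0//.
  by rewrite lee_fin ltW// arrival_law_gt0.
rewrite exprS EFinM; apply: lee_pmul.
- by rewrite lee_fin ltW.
- by rewrite lee_fin exprn_ge0// ltW.
- by rewrite lee_fin.
apply: IH; first exact: blocked_next.
  by move=> i; rewrite nx; case: (i =P j) => [->|_] /=; [lia|rewrite addr0].
move: lt; rewrite /l1 (bigD1 j)//= [X in _ -> (X <= _)%N](bigD1 j)//= nx eqxx.
rewrite [X in _ -> (_ + X <= _)%N](eq_bigr (fun i => `|bal u i|%N)); last first.
  by move=> i /negbTE ij; rewrite nx ij addr0.
by move: (\sum_(_ | _) _)%N (bal u j) uj0 => x y; lia.
Qed.

(** [N] allows one push and then [n * step_bound] unit arrivals. The empty state itself falls under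
    the push case, so its return is covered too. *)
Lemma hit_near u (N := (n * step_bound).+1) : blocked A u.1 u.2 ->
  (l1 (bal u) <= r)%N -> ((d ^+ N)%:E <= hit P e N u)%E.
Proof.
move=> bl lu.
case: (boolP ([forall i, bal u i <= 0] && (0 < l1 (bal u))%N)) => [/andP[/forallP u0 l0]|nu].
  have ue : u != e.
    apply: contraTneq l0 => ->; rewrite l1_gt0; apply/existsPn => i.
    by rewrite negbK /balance /= mulmx0 !mxE.
  have := @reach_below N u bl u0; rewrite /reach (negbTE ue); apply.
  rewrite (leq_trans lu)// /N /step_bound; move: n_gt0 (total_incidence * _)%N => n0 w; nia.
rewrite /N hit_reach.
apply: (@le_trans _ _ (\sum_j (law j)%:E * (d ^+ (n * step_bound))%:E)%E).
  rewrite -ge0_sume_distrl; last by move=> j _; rewrite lee_fin ltW// arrival_law_gt0.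
  rewrite sumEFin (sum_arrival_law n_gt0 lam_gt0) mul1e lee_fin exprS ler_piMl ?d_le1//.
  by rewrite exprn_ge0// ltW.
apply: lee_sum => j _; apply: lee_wpmul2l; first by rewrite lee_fin ltW// arrival_law_gt0.
apply: reach_below; [exact: blocked_next|exact: push_below|exact: l1_bal_next_le].
Qed.

End Reach.

Variable eta : R.
Hypothesis eta_gt0 : 0 < eta.
Hypothesis drift : forall z : 'I_n -> R,
    \sum_i z i * (law i - \sum_k (A i k)%:R *
       (if 0 < \sum_i z i * (A i k)%:R then C%:R else 0)) <= - eta * \sum_i `|z i|.
(** Bounds the decrease under the threshold rule only; being free of [r], it leaves [r_large]
    satisfiable. *)
Let B : R := (total_incidence * C)%:R.
Hypothesis r_large : n%:R * (1 + B) ^+ 2 + 1 <= 2 * eta * r%:R.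

Definition energy (z : 'I_n -> int) : R := \sum_i (z i)%:~R ^+ 2.

Lemma energy_far u : (r < l1 (bal u))%N ->
  1 + \sum_j law j * energy (bal (next u j)) <= energy (bal u).
Proof.
move=> ru; pose z i : R := (bal u i)%:~R.
pose b i : R := \sum_k (A i k)%:R * (if 0 < \sum_i z i * (A i k)%:R then C%:R else 0).
have pE i : (((A *m push (bal u))%R i ord0)%:R : R) = b i.
  rewrite natmx_mulE natr_sum; apply: eq_bigr => k _; rewrite natrM; congr (_ * _).
  rewrite /push leqNgt ru /= mxE.
  have -> : \sum_i z i * (A i k)%:R = (\sum_i bal u i * (A i k)%:Z)%:~R :> R.
    by rewrite rmorph_sum; apply: eq_bigr => l _; rewrite rmorphM.
  by rewrite ltr0z; case: ifP.
have EE j : energy (bal (next u j)) = \sum_i (z i + (i == j)%:R - b i) ^+ 2.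
  apply: eq_bigr => i _; rewrite bal_next rmorphB rmorphD /= -pE.
  by congr ((_ + _ - _) ^+ 2).
have bB i : 0 <= b i <= B.
  apply/andP; split; first by apply: sumr_ge0 => k _; rewrite mulr_ge0//; case: ifP.
  apply: (@le_trans _ _ (\sum_k (A i k)%:R * C%:R)).
    by apply: ler_sum => k _; rewrite ler_wpM2l//; case: ifP.
  rewrite -mulr_suml /B natrM ler_wpM2r// -natr_sum ler_nat /total_incidence.
  by rewrite [X in (_ <= X)%N](bigD1 i)//= leq_addr.
have law0 j : 0 <= law j by rewrite ltW// arrival_law_gt0.
have := sq_step z law0 (sum_arrival_law n_gt0 lam_gt0) bB.
under eq_bigr do rewrite -EE.
have := drift z; rewrite -/b.
have zl : r%:R <= \sum_i `|z i|.
  have -> : \sum_i `|z i| = (l1 (bal u))%:R.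
    by rewrite natr_sum; apply: eq_bigr => i _; rewrite /z natr_absz intr_norm.
  by rewrite ler_nat ltnW.
have := ler_wpM2l (ltW eta_gt0) zl; rewrite -[\sum_i z i ^+ 2]/(energy (bal u)).
by move: r_large; lra.
Qed.

Lemma energy_near u : (l1 (bal u) <= r)%N ->
  \sum_j law j * energy (bal (next u j)) <= n%:R * step_bound%:R ^+ 2.
Proof.
move=> lu; have law0 j : 0 <= law j by rewrite ltW// arrival_law_gt0.
apply: (@le_trans _ _ (\sum_j law j * (n%:R * step_bound%:R ^+ 2))).
  apply: ler_sum => j _; rewrite ler_wpM2l// mulr_natl.
  rewrite -[X in _ *+ X]card_ord -sumr_const; apply: ler_sum => i _.
  rewrite -real_normK ?num_real// lerXn2r ?nnegrE// -intr_norm -natr_absz ler_nat.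
  exact: bal_next_le.
by rewrite -mulr_suml (sum_arrival_law n_gt0 lam_gt0) mul1r.
Qed.

Lemma energy_ge0 z : 0 <= energy z.
Proof. by apply: sumr_ge0 => i _; exact: sqr_ge0. Qed.

Lemma push_stable : stable lam pol.
Proof.
move=> u [eu _].
have [d d_gt0 d_law] := pos_lower_bound (arrival_law_gt0 n_gt0 lam_gt0).
pose N := (n * step_bound).+1.
(* [c] bounds [1] plus the mean energy after a step from near the origin; with weight [c / d ^+ N],
   a hitting chance of [d ^+ N] pays for it. *)
pose c : R := n%:R * step_bound%:R ^+ 2 + 1.
have c0 : 0 <= c by rewrite addr_ge0// mulr_ge0// exprn_ge0.
have dN : 0 < d ^+ N by rewrite exprn_gt0.
(* The value [+oo] makes the drift inequality void at unblocked states; blocked states lead only to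
   blocked ones, so their expectations stay finite. *)
pose V (v : chain_state pol) : \bar R :=
  if `[< blocked A v.1 v.2 >] then (energy (bal v))%:E else +oo%E.
have V0 v : (0 <= V v)%E by rewrite /V; case: ifP => // _; rewrite lee_fin energy_ge0.
have [|v|H [H0 Hfin hH]] :=
  @foster_hit R _ P pol_ge0 pol_sum1 e V (c / d ^+ N) N _ V0.
- by rewrite divr_ge0// ltW.
- rewrite {2}/V; case: ifPn => [/asboolP bl|_]; last by rewrite addye ?leey.
  have -> : \esum_(w in setT) (P v w * V w)%E =
      (\sum_j law j * energy (bal (next v j)))%:E.
    rewrite esum_pending_transition// -sumEFin; apply: eq_bigr => j _; rewrite /V.
    by rewrite asboolT ?EFinM//; exact: blocked_next.
  have := surv_hit pol_ge0 pol_sum1 e N v; have := surv_ge0 pol_ge0 e N v.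
  have := hit_ge0 pol_ge0 e N v.
  have near : (l1 (bal v) <= r)%N -> ((d ^+ N)%:E <= hit P e N v)%E by exact: hit_near.
  move: near; rewrite -(fineK (surv_fin pol_ge0 pol_sum1 e N v)).
  rewrite -(fineK (hit_fin pol_ge0 pol_sum1 e N v)).
  move: (fine _) (fine _) => s h; rewrite !lee_fin => near h0 s0 [sh].
  have K0 : 0 <= c / d ^+ N by rewrite divr_ge0// ltW.
  have [lu|lu] := leqP (l1 (bal v)) r; last first.
    have := energy_far lu; have : s <= 1 by lra.
    by move=> /(ler_wpM2l K0); rewrite mulr1; lra.
  have := energy_near lu; have := energy_ge0 (bal v).
  have : s <= 1 - d ^+ N by have := near lu; lra.
  move=> /(ler_wpM2l K0); rewrite mulrBr mulr1 divfK ?gt_eqF// /c; lra.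
apply: (foster_class pol_ge0 pol_sum1 H0 _ hH eu); apply: Hfin.
rewrite /V asboolT ?ltry// => k.
by rewrite /= mxE.
Qed.

End Stability.

Lemma support_stabilizable (R : realType) (n m : nat) (n_gt0 : (0 < n)%N)
    (A : 'M[nat]_(n, m)) (lam : 'cV[R]_n) (lam_gt0 : forall i, 0 < lam i 0)
    (mu : 'cV[R]_m) : (forall k, 0 <= mu k 0) -> real_mx R A *m mu = lam ->
  surjective_mx (supp_cols (real_mx R A) mu) -> stabilizable A lam.
Proof.
move=> mu0 Amu smu; pose T := \sum_i lam i 0.
have T_gt0 : 0 < T by exact: sum_lam_gt0.
have suppE : supp (T^-1 *: mu) = supp mu.
  by apply/setP => k; rewrite !inE mxE mulf_eq0 invr_eq0 gt_eqF.
have A_row i := surjective_row i smu.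
have snu : surjective_mx (supp_cols (real_mx R A) (T^-1 *: mu)).
  by rewrite /supp_cols suppE.
have [|i|C [eta eta_gt0 drift]] := threshold_drift (q := arrival_law lam) _ _ snu.
- by move=> k; rewrite mxE mulr_ge0// invr_ge0 ltW.
- rewrite /arrival_law -/T -Amu mxE mulr_suml; apply: eq_bigr => k _.
  by rewrite !mxE mulrCA mulrC mulrA.
pose E : R := n%:R * (1 + (total_incidence A * C)%:R) ^+ 2 + 1.
pose r := (Num.truncn (E / (2 * eta))).+1.
have eta2 : 0 < 2 * eta by rewrite mulr_gt0.
have rE : E <= 2 * eta * r%:R.
  by rewrite mulrC -ler_pdivrMr// ltW// truncnS_gt.
exists (@pending_policy R n m A _ _ (@push_le n m A C r)).
exact: (push_stable n_gt0 lam_gt0 A_row eta_gt0 drift rE).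
Qed.

Unset Implicit Arguments.
Set Strict Implicit.

Theorem theorem3p1 (R : realType) (n m : nat) (n_gt0 : (0 < n)%N)
    (A : 'M[nat]_(n, m)) (A_neq0 : forall k, col k A != 0)
    (lam : 'cV[R]_n) (lam_gt0 : forall i, 0 < lam i 0) :
  [<-> stabilizable A lam;
       forall y : 'cV[R]_n, y != 0 ->
         (forall k, 0 <= dotp y (col k (real_mx R A))) -> 0 < dotp y lam;
       surjective_mx (real_mx R A) /\
         exists mu : 'cV[R]_m,
           (forall k, 0 < mu k 0) /\ real_mx R A *m mu = lam;
       interior (cone (real_mx R A)) lam;
       exists mu : 'cV[R]_m,
         [/\ forall k, 0 <= mu k 0, real_mx R A *m mu = lam
           & surjective_mx (supp_cols (real_mx R A) mu)] ].
Proof.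
split; [|split; [|split; [|split]]].
- move=> [p st]; exact: (stable_dual n_gt0 lam_gt0 st).
- move=> dual; split; first exact: dual_surjective dual.
  exact: dual_positive_solution dual.
- by move=> [sA]; exact: positive_solution_interior.
- exact: interior_support.
- move=> [mu [mu0 Amu smu]]; exact: support_stabilizable smu.
Qed.
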